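(* Let $\phi:\mathbb{R}^n\setminus\{0\}\to\mathbb{G}(1,E)$ be a homogeneous line bundle whose restriction to $S^{n-1}$ is Lipschitz, and let $\mu\in M_\phi(\mathbb{R}^n,E)$. Suppose there exist $2$-dimensional linear subspaces $V_1,\dots,V_l\subset\mathbb{R}^n$ and linear subspaces $W_1,\dots,W_l\subset E$ (of arbitrary dimension) such that $\phi(\xi)\subset W_i$ for all $\xi\in V_i\setminus\{0\}$, $i=1,\dots,l$, and $\bigcap_{j=1}^l W_j=\{0\}$. Then $\dim_H(\mu)\ge2$.
   Context: $E=\mathbb{C}^m$; $\mathbb{G}(1,E)$ is the Grassmannian of one-dimensional subspaces of $E$, with a standard metric (e.g. operator norm of the difference of orthogonal projections). A homogeneous line bundle is a continuous map $\phi:\mathbb{R}^n\setminus\{0\}\to\mathbb{G}(1,E)$ with $\phi(a\xi)=\phi(\xi)$ for $a>0$. $M_\phi(\mathbb{R}^n,E)$ is the set of finite $E$-valued Borel measures $\mu$ on $\mathbb{R}^n$ with $\hat\mu(\xi)\in\phi(\xi)$ for all $\xi\ne0$ (Fourier transform $\hat\mu(\xi)=\int e^{-2\pi i\langle\xi,x\rangle}d\mu(x)$, coordinatewise). $\dim_H(\mu)=\inf\{\dim_H F: F\text{ Borel},\ \mu(F)\neq0\}$. *)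

(* Defs.v *)
From HB Require Import structures.
From mathcomp Require Import all_boot all_order all_algebra all_classical all_reals all_analysis.
From mathcomp Require Import complex.
Set Implicit Arguments. Unset Strict Implicit. Unset Printing Implicit Defensive.
Import Order.TTheory GRing.Theory Num.Theory numFieldTopology.Exports numFieldNormedType.Exports.
Local Open Scope classical_set_scope.
Local Open Scope ring_scope.
Local Open Scope complex_scope.

Section Defs.
Context {R : realType}.

Definition Rn (n : nat) := g_sigma_algebraType (@open ('rV[R]_n : topologicalType)).

Definition enorm {n} (x : 'rV[R]_n) : R := Num.sqrt (\sum_i x ord0 i ^+ 2).
Definition dotR {n} (x y : 'rV[R]_n) : R := \sum_i x ord0 i * y ord0 i.

Definition cnorm {m} (v : 'rV[R[i]]_m) : R :=
  Num.sqrt (\sum_i (complex.Re (v ord0 i) ^+ 2 + complex.Im (v ord0 i) ^+ 2)).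

Definition conjT {m} (A : 'M[R[i]]_m) : 'M[R[i]]_m := (map_mx (@conjc R) A)^T.

(** The Grassmannian G(1,E) is represented by the orthogonal projections of
    rank one (a line <-> the orthogonal projection onto it; the line is the
    row space of the projection). *)
Definition is_line_proj {m} (P : 'M[R[i]]_m) : Prop :=
  P *m P = P /\ conjT P = P /\ \rank P = 1%N.

Definition opnorm {m} (A : 'M[R[i]]_m) : R :=
  sup [set cnorm (x *m A) | x in [set x : 'rV[R[i]]_m | cnorm x <= 1]].
Definition gdist {m} (P Q : 'M[R[i]]_m) : R := opnorm (P - Q).

Definition homogeneous_line_bundle {n m} (phi : 'rV[R]_n -> 'M[R[i]]_m) : Prop :=
  [/\ (forall xi, xi != 0 -> is_line_proj (phi xi)),
      (forall xi (a : R), xi != 0 -> 0 < a -> phi (a *: xi) = phi xi) &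
      (forall xi, xi != 0 -> forall e : R, 0 < e ->
         exists2 d : R, 0 < d & forall eta, eta != 0 ->
           enorm (eta - xi) < d -> gdist (phi eta) (phi xi) < e)].

Definition lipschitz_on_sphere {n m} (phi : 'rV[R]_n -> 'M[R[i]]_m) : Prop :=
  exists L : R, forall xi eta, enorm xi = 1 -> enorm eta = 1 ->
    gdist (phi xi) (phi eta) <= L * enorm (xi - eta).

(** A finite E-valued Borel measure on R^n: each coordinate is a finite
    complex measure, written (Jordan decomposition) as
    (re_pos - re_neg) + i (im_pos - im_neg) with finite positive measures. *)
Record vmeasure (n m : nat) := VMeasure {
  re_pos : 'I_m -> {finite_measure set (Rn n) -> \bar R};
  re_neg : 'I_m -> {finite_measure set (Rn n) -> \bar R};
  im_pos : 'I_m -> {finite_measure set (Rn n) -> \bar R};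
  im_neg : 'I_m -> {finite_measure set (Rn n) -> \bar R} }.

Definition cval {n} (nu : {finite_measure set (Rn n) -> \bar R}) (A : set (Rn n)) : R[i] :=
  (fine (nu A))%:C.

Definition vmeas {n m} (mu : vmeasure n m) (A : set (Rn n)) : 'rV[R[i]]_m :=
  \row_k (cval (re_pos mu k) A - cval (re_neg mu k) A
          + 'i * (cval (im_pos mu k) A - cval (im_neg mu k) A)).

Definition cfourier {n} (nu : {finite_measure set (Rn n) -> \bar R}) (xi : 'rV[R]_n) : R[i] :=
  (fine (\int[nu]_x (cos (2 * pi * dotR xi x))%:E)%E)%:C
  - 'i * (fine (\int[nu]_x (sin (2 * pi * dotR xi x))%:E)%E)%:C.

Definition vfourier {n m} (mu : vmeasure n m) (xi : 'rV[R]_n) : 'rV[R[i]]_m :=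
  \row_k (cfourier (re_pos mu k) xi - cfourier (re_neg mu k) xi
          + 'i * (cfourier (im_pos mu k) xi - cfourier (im_neg mu k) xi)).

Definition in_M_phi {n m} (phi : 'rV[R]_n -> 'M[R[i]]_m) (mu : vmeasure n m) : Prop :=
  forall xi, xi != 0 -> (vfourier mu xi <= phi xi)%MS.

Definition diam {n} (U : set 'rV[R]_n) : \bar R :=
  ereal_sup [set (enorm (x - y))%:E | x in U & y in U].

Definition hcost {n} (s : R) (U : set 'rV[R]_n) : \bar R :=
  if `[< U = set0 >] then 0%E else ((fine (diam U)) `^ s)%:E.

Definition hcontent_delta {n} (s delta : R) (F : set 'rV[R]_n) : \bar R :=
  ereal_inf [set (\sum_(0 <= i <oo) hcost s (U i))%E
    | U in [set U : nat -> set 'rV[R]_n |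
              F `<=` \bigcup_i U i /\ forall i, (diam (U i) <= delta%:E)%E]].

Definition hausdorff_measure {n} (s : R) (F : set 'rV[R]_n) : \bar R :=
  ereal_sup [set hcontent_delta s d F | d in [set d : R | 0 < d]].

Definition hausdorff_dim {n} (F : set 'rV[R]_n) : \bar R :=
  ereal_inf [set s%:E | s in [set s : R | 0 <= s /\ hausdorff_measure s F = 0%E]].

Definition hausdorff_dim_measure {n m} (mu : vmeasure n m) : \bar R :=
  ereal_inf [set hausdorff_dim F
    | F in [set F : set (Rn n) | measurable F /\ vmeas mu F != 0]].

End Defs.

(* Main.v *)
(* Fix V = V_i and a column w with W_i w = 0.  For xi in V the line phi(xi) is
   killed by w, and by the Lipschitz condition phi(xi + eta) is within
   O(|eta| / |xi|) of it, so the Fourier transform of the scalar measure mu w at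
   xi + eta is O(1 / |xi|).  Push e^{2 pi i <eta, x>} mu w forward to the
   two-dimensional torus V / lattice: its Fourier coefficients are O(1 / |xi|),
   which makes it small against periodic functions h of small fractional energy.
   If h is the maximum of finitely many bumps on balls of radii r_i, this energy
   is controlled by the sum of r_i^s, for any s < 2.
   Let F have zero s-dimensional Hausdorff measure.  The limsup f0 of such maxima
   along finer and finer coverings of F equals 1 on F, and the integral of
   f0 e^{2 pi i <eta, x>} against mu w vanishes for every eta.  By Fourier
   uniqueness f0 mu w = 0, hence mu(F) w = 0.  As w was arbitrary, mu(F) lies in
   W_i for each i, and therefore mu(F) = 0. *)

Require Import Defs.
From HB Require Import structures.
From mathcomp Require Import all_boot all_order all_algebra all_classical all_reals all_analysis.
From mathcomp Require Import complex measurable_realfun.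
From mathcomp Require Import ring lra zify.
Set Implicit Arguments.
Unset Strict Implicit.
Unset Printing Implicit Defensive.
Import Order.TTheory GRing.Theory Num.Theory numFieldTopology.Exports numFieldNormedType.Exports.
Local Open Scope classical_set_scope.
Local Open Scope ring_scope.

(** * Trigonometric sums on a grid *)

(** Decay of order 1 / |xi| is the borderline case in dimension two: a dyadic block of frequencies
    of size 2^j has about 4^j members, so Cauchy-Schwarz uses up the decay exactly. Any geometric
    gain in the energy of [h] on the blocks then makes the sum finite, and bumps of radius r provide
    it through min(r, z)^2 <= r^s z^(2-s) with s < 2. A maximum of bumps replaces their sum because
    nothing bounds the overlap of the coverings: the squared increment of a maximum is at most the
    sum of the squared increments, without cross terms. Energy is measured by increments under
    translation, and the analysis on the torus uses real sines and cosines on finite grids, so that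
    neither Fourier series nor integrals over the torus occur. Only Fejer means of [h], which are
    trigonometric polynomials, meet the measure. The twist by [eta] is what lets one plane suffice:
    for [eta = 0] alone only the total integral of [f0] against mu w would be known to vanish. The
    Lipschitz condition pays for it. *)

Lemma ler_norm_sin (R : realType) (x : R) : `|sin x| <= `|x|.
Proof.
wlog x0 : x / 0 <= x.
  move=> H; have [|/ltW x0] := leP 0 x; first exact: H.
  by rewrite -normrN -sinN -[leRHS]normrN; apply: H; rewrite oppr_ge0.
have [->|xN0] := eqVneq x 0; first by rewrite sin0.
have xgt0 : 0 < x by rewrite lt_neqAle eq_sym xN0.
have [c _] : exists2 c, c \in `]0, x[%R & sin x - sin 0 = cos c * (x - 0).
  apply: (@MVT R sin cos 0 x) => //.
  by apply: continuous_subspaceT => y; exact: continuous_sin.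
by rewrite sin0 !subr0 => ->; rewrite normrM ler_piMl// cos_max.
Qed.

Lemma norm_sinD (R : realType) (x y : R) : `|sin (x + y)| <= `|sin x| + `|sin y|.
Proof.
rewrite sinD (le_trans (ler_normD _ _))// !normrM lerD//.
  by rewrite ler_piMr// cos_max.
by rewrite ler_piMl// cos_max.
Qed.

Lemma norm_sin_natmul (R : realType) (k : nat) (x : R) :
  `|sin (k%:R * x)| <= k%:R * `|sin x|.
Proof.
elim: k => [|k IH]; first by rewrite !mul0r sin0 normr0.
rewrite -natr1 !mulrDl !mul1r (le_trans (norm_sinD _ _))// lerD2r//.
Qed.

Lemma cos_sin_half (R : realType) (x : R) : cos (2 * x) = 1 - 2 * sin x ^+ 2.
Proof.
have -> : cos (2 * x) = cos x ^+ 2 * 2 - 1 by rewrite (mulrC 2) mulr_natr cos_mulr2n mulr_natr.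
by rewrite cos2sin2; ring.
Qed.

Lemma sinBnat2pi (R : realType) (x : R) (k : nat) : sin (k%:R * (pi *+ 2) - x) = - sin x.
Proof.
rewrite -sinN addrC mulr_natl.
by rewrite (periodicn (@sinD2pi R)).
Qed.

Lemma sum_cos_grid (R : realType) (N j : nat) : (0 < j < N)%N ->
  \sum_(y < N) cos (2 * pi * j%:R * (y%:R / N%:R)) = 0 :> R.
Proof.
move=> /andP[j0 jN]; have N0 : (0 < N)%N by apply: leq_trans jN.
have NN0 : N%:R != 0 :> R by rewrite pnatr_eq0 -lt0n.
set a : R := pi * j%:R / N%:R.
have sa : sin a != 0.
  rewrite gt_eqF// sin_gt0_pi// /a divr_gt0 ?mulr_gt0 ?ltr0n ?pi_gt0//=.
  by rewrite ltr_pdivrMr ?ltr0n// ltr_pM2l ?pi_gt0// ltr_nat.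
(* The factor [2 * sin a] makes the sum telescope; it is nonzero since [0 < a < pi]. *)
have H n : 2 * sin a * \sum_(y < n) cos (2 * pi * j%:R * (y%:R / N%:R))
     = sin (n%:R * (2 * a) - a) + sin a.
  elim: n => [|n IH]; first by rewrite big_ord0 mul0r sub0r sinN mulr0 addNr.
  rewrite big_ord_recr/= mulrDr IH.
  have -> : 2 * pi * j%:R * (n%:R / N%:R) = n%:R * (2 * a) by rewrite /a; field.
  have -> : n.+1%:R * (2 * a) - a = n%:R * (2 * a) + a by rewrite -[n.+1%:R]natr1; ring.
  by rewrite sinB sinD; ring.
have sa2 : 2 * sin a != 0 by rewrite mulf_neq0// pnatr_eq0.
apply: (mulfI sa2); rewrite mulr0 H.
have -> : N%:R * (2 * a) = j%:R * (pi *+ 2) by rewrite /a -mulr_natl; field.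
by rewrite sinBnat2pi addNr.
Qed.

Lemma sum_sin_grid (R : realType) (N j : nat) : (j < N)%N ->
  \sum_(y < N) sin (2 * pi * j%:R * (y%:R / N%:R)) = 0 :> R.
Proof.
move=> jN; have N0 : (0 < N)%N by apply: leq_trans jN.
have NN0 : N%:R != 0 :> R by rewrite pnatr_eq0 -lt0n.
have [->|j0] := posnP j.
  by rewrite big1// => i _; rewrite mulr0 mul0r sin0.
set a : R := pi * j%:R / N%:R.
have sa : sin a != 0.
  rewrite gt_eqF// sin_gt0_pi// /a divr_gt0 ?mulr_gt0 ?ltr0n ?pi_gt0//=.
  by rewrite ltr_pdivrMr ?ltr0n// ltr_pM2l ?pi_gt0// ltr_nat.
have H n : 2 * sin a * \sum_(y < n) sin (2 * pi * j%:R * (y%:R / N%:R))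
     = cos a - cos (n%:R * (2 * a) - a).
  elim: n => [|n IH]; first by rewrite big_ord0 mul0r sub0r cosN mulr0 subrr.
  rewrite big_ord_recr/= mulrDr IH.
  have -> : 2 * pi * j%:R * (n%:R / N%:R) = n%:R * (2 * a) by rewrite /a; field.
  have -> : n.+1%:R * (2 * a) - a = n%:R * (2 * a) + a by rewrite -[n.+1%:R]natr1; ring.
  by rewrite cosB cosD; ring.
have sa2 : 2 * sin a != 0 by rewrite mulf_neq0// pnatr_eq0.
apply: (mulfI sa2); rewrite mulr0 H.
have -> : N%:R * (2 * a) = j%:R * (pi *+ 2) by rewrite /a -mulr_natl; field.
have -> : j%:R * (pi *+ 2) - a = - a + pi *+ 2 *+ j by rewrite mulr_natl addrC.
by rewrite (periodicn (@cosD2pi R)) cosN subrr.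
Qed.

(* [(true, k)] stands for the sine and [(false, k)] for the cosine of frequency [k];
   [sin 0 = 0] is among them, which does no harm. *)
Definition tg {R : realType} (a : bool * nat) (t : R) : R :=
  if a.1 then sin (2 * pi * a.2%:R * t) else cos (2 * pi * a.2%:R * t).

Definition gmean {R : realType} (N : nat) (f : R -> R) : R :=
  N%:R^-1 * \sum_(y < N) f (y%:R / N%:R).

Section GridMean.
Context {R : realType} (N : nat).
Implicit Types f g : R -> R.

Lemma eq_gmean f g : f =1 g -> gmean N f = gmean N g.
Proof. by move=> fg; congr (_ * _); apply: eq_bigr. Qed.

Lemma gmeanD f g : gmean N (fun y => f y + g y) = gmean N f + gmean N g.
Proof. by rewrite /gmean big_split mulrDr. Qed.

Lemma gmeanZ c f : gmean N (fun y => c * f y) = c * gmean N f.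
Proof. by rewrite /gmean -mulr_sumr mulrCA. Qed.

Lemma gmeanZr c f : gmean N (fun y => f y * c) = gmean N f * c.
Proof. by rewrite mulrC -gmeanZ; apply: eq_gmean => y; rewrite mulrC. Qed.

Lemma gmean_sum (I : Type) (r : seq I) (P : pred I) (F : I -> R -> R) :
  gmean N (fun y => \sum_(i <- r | P i) F i y) = \sum_(i <- r | P i) gmean N (F i).
Proof. by rewrite /gmean exchange_big mulr_sumr. Qed.

Lemma ler_gmean f g : (forall y, f y <= g y) -> gmean N f <= gmean N g.
Proof. by move=> fg; rewrite ler_wpM2l ?invr_ge0//; apply: ler_sum. Qed.

Lemma gmean_ge0 f : (forall y, 0 <= f y) -> 0 <= gmean N f.
Proof. by move=> f0; rewrite mulr_ge0 ?invr_ge0//; apply: sumr_ge0. Qed.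

Lemma ler_norm_gmean f : `|gmean N f| <= gmean N (fun y => `|f y|).
Proof.
by rewrite normrM ger0_norm ?invr_ge0// ler_wpM2l ?invr_ge0// ler_norm_sum.
Qed.

Hypothesis N0 : (0 < N)%N.

Lemma gmean_cst c : gmean N (fun=> c) = c :> R.
Proof.
by rewrite /gmean sumr_const card_ord -[c *+ _]mulr_natl mulKf// pnatr_eq0 -lt0n.
Qed.

Lemma gmean_shift f (d : nat) : (forall t, f (t + 1) = f t) ->
  gmean N (fun y => f (y + d%:R / N%:R)) = gmean N f.
Proof.
move=> fp; elim: d => [|d <-]; first by apply: eq_gmean => y; rewrite mul0r addr0.
rewrite /gmean; congr (_ * _).
have NN0 : N%:R != 0 :> R by rewrite pnatr_eq0 -lt0n.
pose F i : R := f (i%:R / N%:R + d%:R / N%:R).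
rewrite [RHS](_ : _ = \sum_(y < N) F y)//.
rewrite (eq_bigr (fun y : 'I_N => F y.+1)); last first.
  by move=> i _; rewrite /F; congr f; rewrite -[d.+1%:R]natr1 -[i.+1%:R]natr1; field.
apply: (@addrI _ (F 0%N)); rewrite -(big_mkord xpredT F) -(big_mkord xpredT (fun y => F y.+1)).
rewrite -big_nat_recl//.
rewrite big_nat_recr//= addrC; congr (_ + _).
by rewrite /F divff// mul0r add0r addrC fp.
Qed.

End GridMean.

Section Trig.
Context {R : realType}.
Implicit Types (t : R) (a : bool * nat).

Lemma normr_tg a t : `|tg a t| <= 1.
Proof. by rewrite /tg; case: ifP => _; [exact: sin_max|exact: cos_max]. Qed.

Lemma gmean_cos (N j : nat) : (0 < j < N)%N -> gmean N (fun y : R => cos (2 * pi * j%:R * y)) = 0.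
Proof. by move=> jN; rewrite /gmean sum_cos_grid ?mulr0. Qed.

Lemma gmean_sin (N j : nat) : (j < N)%N -> gmean N (fun y : R => sin (2 * pi * j%:R * y)) = 0.
Proof. by move=> jN; rewrite /gmean sum_sin_grid ?mulr0. Qed.

(** Product-to-sum formulas leave the frequencies [k + l] and [k - l]. The bound [k + l < N] rules
    out aliasing on the grid, so both means vanish. *)
Lemma gmean_tg_mul (N : nat) a a' : (a.2 + a'.2 < N)%N -> a != a' ->
  gmean N (fun y : R => tg a y * tg a' y) = 0.
Proof.
wlog kl : a a' / (a'.2 <= a.2)%N.
  move=> H; case: (leqP a'.2 a.2) => [|/ltnW] h; first exact: H.
  move=> ? ?; under eq_gmean do rewrite mulrC.
  by apply: H => //; rewrite ?(addnC a'.2) // eq_sym.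
case: a a' kl => [b k] [b' l] /= kl klN ne.
pose A (y : R) := 2 * pi * (k - l)%:R * y; pose B (y : R) := 2 * pi * (k + l)%:R * y.
have EA y : A y = 2 * pi * k%:R * y - 2 * pi * l%:R * y by rewrite /A natrB//; ring.
have EB y : B y = 2 * pi * k%:R * y + 2 * pi * l%:R * y by rewrite /B natrD; ring.
have klN' : (k - l < N)%N by lia.
rewrite /tg/=; case: b b' ne => -[] ne.
- have kl' : (0 < k - l)%N by rewrite subn_gt0 ltn_neqAle kl andbT; apply: contra_neq ne => ->.
  rewrite (@eq_gmean _ _ _ (fun y => 2^-1 * cos (A y) + (- 2^-1) * cos (B y))).
    by rewrite gmeanD !gmeanZ !gmean_cos ?mulr0 ?addr0//; lia.
  by move=> y; rewrite EA EB cosB cosD; field.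
- rewrite (@eq_gmean _ _ _ (fun y => 2^-1 * sin (A y) + 2^-1 * sin (B y))).
    by rewrite gmeanD !gmeanZ !gmean_sin ?mulr0 ?addr0//; lia.
  by move=> y; rewrite EA EB sinB sinD; field.
- rewrite (@eq_gmean _ _ _ (fun y => (- 2^-1) * sin (A y) + 2^-1 * sin (B y))).
    by rewrite gmeanD !gmeanZ !gmean_sin ?mulr0 ?addr0//; lia.
  by move=> y; rewrite EA EB sinB sinD; field.
- have kl' : (0 < k - l)%N by rewrite subn_gt0 ltn_neqAle kl andbT; apply: contra_neq ne => ->.
  rewrite (@eq_gmean _ _ _ (fun y => 2^-1 * cos (A y) + 2^-1 * cos (B y))).
    by rewrite gmeanD !gmeanZ !gmean_cos ?mulr0 ?addr0//; lia.
  by move=> y; rewrite EA EB cosB cosD; field.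
Qed.

Definition ix (L : nat) (a : bool * 'I_L) : bool * nat := (a.1, nat_of_ord a.2).

(** Orthogonality and [|tg| <= 1] are enough. The system is not normalized (a positive frequency has
    mean square 1/2), but this only makes the mean square of [P] smaller than the sum of the
    [c a ^+ 2], which is the favourable direction. *)
Lemma bessel (L N : nat) (f : R -> R) : (0 < N)%N -> (L + L <= N)%N ->
  \sum_(a : bool * 'I_L) gmean N (fun y => f y * tg (ix a) y) ^+ 2
    <= gmean N (fun y => f y ^+ 2).
Proof.
move=> N0 LN; pose c (a : bool * 'I_L) := gmean N (fun y => f y * tg (@ix L a) y).
rewrite -[X in X <= _](_ : \sum_a c a ^+ 2 = _)//.
pose P y := \sum_a c a * tg (@ix L a) y.
have H0 : 0 <= gmean N (fun y => (f y - P y) ^+ 2).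
  by apply: gmean_ge0 => y; rewrite sqr_ge0.
have E1 : gmean N (fun y => (f y - P y) ^+ 2) =
    gmean N (fun y => f y ^+ 2) + (- 2) * gmean N (fun y => f y * P y)
     + gmean N (fun y => P y * P y).
  by rewrite -gmeanZ -!gmeanD; apply: eq_gmean => y; ring.
have E2 : gmean N (fun y => f y * P y) = \sum_a c a ^+ 2.
  rewrite (@eq_gmean _ _ _ (fun y => \sum_a c a * (f y * tg (ix a) y))).
    by rewrite gmean_sum; apply: eq_bigr => a _; rewrite gmeanZ expr2.
  by move=> y; rewrite mulr_sumr; apply: eq_bigr => a _; rewrite mulrCA.
have E3 : gmean N (fun y => P y * P y) <= \sum_a c a ^+ 2.
  rewrite (@eq_gmean _ _ _ (fun y => \sum_a \sum_a' (c a * c a') * (tg (ix a) y * tg (ix a') y))).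
    rewrite gmean_sum; apply: ler_sum => a _; rewrite gmean_sum (bigD1 a)//= big1 ?addr0.
      rewrite gmeanZ -expr2 ler_piMr ?sqr_ge0//.
      rewrite -[leRHS](@gmean_cst R _ N0); apply: ler_gmean => y.
      by rewrite -expr2 -real_normK ?num_real// expr_le1// normr_tg.
    move=> a' a'a; rewrite gmeanZ gmean_tg_mul ?mulr0//=.
      by rewrite (leq_trans _ LN)// -addnS leq_add// ltnW.
    apply: contra_neq a'a => -[]; case: a a' => [b k] [b' k'] /= -> /val_inj ->//.
  move=> y; rewrite mulr_suml; apply: eq_bigr => a _; rewrite mulr_sumr.
  by apply: eq_bigr => a' _; ring.
by move: H0; rewrite E1 E2; lra.
Qed.

End Trig.

(** * The Fejer kernel *)

Section Fejer.
Context {R : realType}.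
Implicit Types (t : R).

Definition fejc (K k : nat) : R := if k == 0%N then 1 else 2 * (1 - k%:R / K%:R).

Definition fej (K : nat) (t : R) : R := \sum_(k < K) fejc K k * cos (2 * pi * k%:R * t).

Lemma fejc_ge0 K k : (k < K)%N -> 0 <= fejc K k.
Proof.
move=> kK; rewrite /fejc; case: ifP => // _.
by rewrite mulr_ge0// subr_ge0 ler_pdivrMr ?ltr0n ?(leq_trans _ kK)// mul1r ler_nat ltnW.
Qed.

Lemma fejc_le2 K k : fejc K k <= 2.
Proof.
rewrite /fejc; case: ifP => // _; first by rewrite ler1n.
by rewrite ler_piMr// gerBl divr_ge0.
Qed.

(** The right side is the squared modulus of the sum of the e^(2 pi i k t). From n to n + 1 both
    sides grow by 1 + 2 sum_(k < n) cos (e n - e k), on the left after reversing the order of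
    summation. *)
Lemma fej_sqr K t : (0 < K)%N ->
  K%:R * fej K t = (\sum_(k < K) cos (2 * pi * k%:R * t)) ^+ 2
                 + (\sum_(k < K) sin (2 * pi * k%:R * t)) ^+ 2.
Proof.
move=> K0; pose e k : R := 2 * pi * k%:R * t.
pose w (k : nat) : R := if k == 0%N then 1 else 2.
pose A (n : nat) : R := \sum_(k < n) (w k * (n%:R - k%:R)) * cos (e k).
have -> : K%:R * fej K t = A K.
  rewrite /fej /A mulr_sumr; apply: eq_bigr => k _; rewrite /fejc /w mulrA; congr (_ * _).
  have KK : K%:R != 0 :> R by rewrite pnatr_eq0 -lt0n.
  by case: eqP => [->|_]; [rewrite mulr1 subr0 mul1r|field].
rewrite {K0}; elim: K => [|n IH]; first by rewrite /A !big_ord0 expr0n/= addr0.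
have -> : A n.+1 = A n + 1 + 2 * \sum_(k < n) cos (e k.+1).
  rewrite /A big_ord_recr/= -[n.+1%:R]natr1.
  have -> : w n * (n%:R + 1 - n%:R) * cos (e n)
      = w n * cos (e n) by ring.
    have -> : \sum_(i < n) w i * (n%:R + 1 - i%:R) * cos (e i)
    = \sum_(i < n) w i * (n%:R - i%:R) * cos (e i)
     + \sum_(i < n) w i * cos (e i).
    by rewrite -big_split/=; apply: eq_bigr => i _; ring.
  rewrite -!addrA; congr (_ + _).
  transitivity (\sum_(i < n.+1) w i * cos (e i)).
    by rewrite big_ord_recr.
  rewrite big_ord_recl/= /w/= /e mulr0 mul0r cos0 mulr1 mulr_sumr; congr (_ + _).
have -> : \sum_(k < n) cos (e k.+1) = \sum_(k < n) cos (e n - e k).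
  rewrite (reindex_inj rev_ord_inj)/=; apply: eq_bigr => i _.
  rewrite subnSK// /e natrB ?(ltnW (ltn_ord i))//; congr cos; ring.
rewrite IH !big_ord_recr/=.
under [\sum_(k < n) cos (e n - e k)]eq_bigr do rewrite cosB.
rewrite big_split/= -!mulr_sumr -[X in _ + X + _ = _](cos2Dsin2 (e n)) /e; ring.
Qed.

Lemma fej_ge0 K t : 0 <= fej K t.
Proof.
have [->|K0] := posnP K; first by rewrite /fej big_ord0.
by rewrite -(pmulr_rge0 _ (_ : 0 < K%:R)) ?ltr0n// fej_sqr// addr_ge0 ?sqr_ge0.
Qed.

Lemma sum_fejc K : (0 < K)%N -> \sum_(k < K) fejc K k = K%:R.
Proof.
move=> K0; have KK : K%:R != 0 :> R by rewrite pnatr_eq0 -lt0n.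
apply: (mulfI KK); have := fej_sqr 0 K0; rewrite /fej.
under eq_bigr do rewrite mulr0 cos0 mulr1.
under [X in _ = X ^+ 2 + _]eq_bigr do rewrite mulr0 cos0.
under [X in _ = _ + X ^+ 2]eq_bigr do rewrite mulr0 sin0.
by move=> ->; rewrite sumr_const card_ord sumr_const mul0rn expr0n addr0 expr2.
Qed.

(** For [k < K] the sine of half the angle is at most [k * rho <= 1/2], so every cosine is at least
    1/2, and the coefficients sum to [K]. *)
Lemma fej_near K t rho : (0 < K)%N -> `|sin (pi * t)| <= rho -> 2 * K%:R * rho <= 1 ->
  K%:R / 2 <= fej K t.
Proof.
move=> K0 st Kr; rewrite -sum_fejc// mulr_suml; apply: ler_sum => k _.
rewrite ler_wpM2l ?fejc_ge0//.
have -> : 2 * pi * k%:R * t = 2 * (k%:R * (pi * t)) by ring.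
rewrite cos_sin_half.
have h : `|sin (k%:R * (pi * t))| <= 2^-1.
  rewrite (le_trans (norm_sin_natmul _ _))//.
  have : k%:R * `|sin (pi * t)| <= K%:R * rho by rewrite ler_pM// ler_nat ltnW.
  by lra.
have : sin (k%:R * (pi * t)) ^+ 2 <= 2^-1 * 2^-1.
  by rewrite -real_normK ?num_real// expr2 ler_pM.
by lra.
Qed.

Lemma gmean_cos_shift (N j : nat) t : (0 < j < N)%N ->
  gmean N (fun y => cos (2 * pi * j%:R * (t - y))) = 0.
Proof.
move=> /andP[j0 jN]; pose e := 2 * pi * j%:R * t.
rewrite (@eq_gmean _ _ _ (fun y => cos e * cos (2 * pi * j%:R * y) + sin e * sin (2 * pi * j%:R * y))).
  by rewrite gmeanD !gmeanZ gmean_cos ?gmean_sin ?j0// !mulr0 addr0.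
by move=> y; rewrite mulrBr cosB.
Qed.

Lemma gmean_fej (N K : nat) t : (0 < K <= N)%N -> gmean N (fun y => fej K (t - y)) = 1.
Proof.
case: K => // K /= KN; rewrite /fej gmean_sum big_ord_recl/= big1 => [|i _].
  rewrite addr0 gmeanZ (@eq_gmean _ _ _ (fun=> 1)) ?gmean_cst ?mulr1 ?(leq_trans _ KN)//.
  by move=> y; rewrite mulr0 mul0r cos0.
rewrite gmeanZ gmean_cos_shift ?mulr0//=; apply: leq_trans KN.
by rewrite /bump add1n ltnS.
Qed.

(** The second moment of the kernel. As sin^2 x = (1 - cos 2x) / 2, only its coefficients 1 and 2 (1
    - 1/K) at the frequencies 0 and 1 contribute. The product with the cosine reaches frequency [K],
    which must stay below [N]. *)
Lemma gmean_fej_sin2 (N K : nat) t : (1 < K < N)%N ->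
  gmean N (fun y => fej K (t - y) * sin (pi * (t - y)) ^+ 2) = (2 * K%:R)^-1.
Proof.
move=> /andP[K1 KN].
have KK : K%:R != 0 :> R by rewrite pnatr_eq0 -lt0n (ltn_trans _ K1).
have C : gmean N (fun y => fej K (t - y) * cos (2 * pi * 1%:R * (t - y))) = 1 - K%:R^-1.
  rewrite (@eq_gmean _ _ _ (fun y => \sum_(k < K) fejc K k *
     (cos (2 * pi * k%:R * (t - y)) * cos (2 * pi * 1%:R * (t - y))))); last first.
    by move=> y; rewrite /fej mulr_suml; apply: eq_bigr => k _; rewrite mulrA.
  rewrite gmean_sum (bigD1 (Ordinal K1))//= big1 => [|k k1].
    rewrite addr0 gmeanZ (@eq_gmean _ _ _ (fun y => 2^-1 + 2^-1 * cos (2 * pi * 2%:R * (t - y)))).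
      rewrite gmeanD gmeanZ gmean_cst ?(leq_ltn_trans _ KN)// gmean_cos_shift; last by lia.
      by rewrite /fejc/=; field.
    move=> y; set x := 2 * pi * 1%:R * _.
    have -> : 2 * pi * 2%:R * (t - y) = 2 * x by rewrite /x; ring.
    by rewrite cos_sin_half sin2cos2; field.
  rewrite gmeanZ; have kK := ltn_ord k.
  have {}k1 : k != 1%N :> nat by apply: contra_neq k1 => k1; apply: val_inj.
  rewrite (_ : gmean _ _ = 0) ?mulr0//.
  have [k0|k0] := posnP k.
    rewrite (@eq_gmean _ _ _ (fun y => cos (2 * pi * 1%:R * (t - y)))) ?gmean_cos_shift//; first by lia.
    by move=> y; rewrite k0 mulr0 mul0r cos0 mul1r.
  rewrite (@eq_gmean _ _ _ (fun y => 2^-1 * cos (2 * pi * k.+1%:R * (t - y)) +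
        2^-1 * cos (2 * pi * k.-1%:R * (t - y)))).
    by rewrite gmeanD !gmeanZ !gmean_cos_shift ?mulr0 ?addr0//; lia.
  move=> y; set x := 2 * pi * k%:R * _; set z := 2 * pi * 1%:R * _.
  have -> : 2 * pi * k.+1%:R * (t - y) = x + z by rewrite /x /z -[k.+1%:R]natr1; ring.
  have -> : 2 * pi * k.-1%:R * (t - y) = x - z.
    by rewrite /x /z -(prednK k0) -[_.-1.+1%:R]natr1/=; ring.
  by rewrite cosD cosB; field.
rewrite (@eq_gmean _ _ _ (fun y => 2^-1 * fej K (t - y)
   + (- 2^-1) * (fej K (t - y) * cos (2 * pi * 1%:R * (t - y))))); last first.
  move=> y; have -> : 2 * pi * 1%:R * (t - y) = 2 * (pi * (t - y)) by ring.
  by rewrite cos_sin_half; field.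
rewrite gmeanD !gmeanZ C gmean_fej; last by lia.
by field.
Qed.

(* A multiple of the Fejer kernel majorizes the indicator function. *)
Lemma gmean_sin_small (N : nat) (c rho : R) : (0 < N)%N -> 0 < rho -> (2 * rho)^-1 <= N%:R ->
  gmean N (fun y => ((`|sin (pi * (c - y))| <= rho)%R : nat)%:R) <= 8 * rho.
Proof.
move=> N0 r0 rN; have [r2|r2] := leP 2^-1 rho.
  apply: (@le_trans _ _ 1); last by lra.
  rewrite -[leRHS](@gmean_cst R N)//; apply: ler_gmean => y.
  by rewrite lern1 leq_b1.
pose K := Num.truncn (2 * rho)^-1.
have x1 : 1 <= (2 * rho)^-1 by rewrite invf_ge1 ?mulr_gt0//; lra.
have Kb : K%:R <= (2 * rho)^-1 < K.+1%:R by apply: truncn_itv; lra.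
have [K1 K2] := andP Kb.
have K0 : (0 < K)%N by rewrite truncn_gt0.
have KN : (K <= N)%N by rewrite -(ler_nat R) (le_trans K1).
have KR : 1 <= K%:R :> R by rewrite ler1n.
have K3 : 2 * K%:R * rho <= 1.
  move: K1; rewrite -[leRHS]mul1r ler_pdivlMr ?mulr_gt0//; lra.
have K4 : 2 / K%:R <= 8 * rho.
  rewrite ler_pdivrMr ?ltr0n//; move: K2; rewrite -[ltLHS]mul1r ltr_pdivrMr ?mulr_gt0//.
  rewrite -[K.+1%:R]natr1; nra.
apply: le_trans K4; rewrite -[leRHS]mulr1 -[X in _ <= _ * X](@gmean_fej N K c) ?K0// -gmeanZ.
apply: ler_gmean => y; case: (leP `|_| rho) => h; last by rewrite mulr_ge0 ?fej_ge0// divr_ge0.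
have := fej_near K0 h K3; rewrite -(ler_pM2l (_ : 0 < 2 / K%:R)) ?divr_gt0 ?ltr0n//.
by apply: le_trans; rewrite mulrA divfK ?mulfV ?pnatr_eq0// -lt0n.
Qed.

End Fejer.

(** * Fourier coefficients on the two-dimensional grid *)

Definition gmean2 {R : realType} (N : nat) (h : R -> R -> R) : R :=
  gmean N (fun y1 => gmean N (fun y2 => h y1 y2)).

Section GridMean2.
Context {R : realType} (N : nat).
Implicit Types h g : R -> R -> R.

Lemma eq_gmean2 h g : (forall y1 y2, h y1 y2 = g y1 y2) -> gmean2 N h = gmean2 N g.
Proof. by move=> hg; apply: eq_gmean => y1; apply: eq_gmean => y2. Qed.

Lemma gmean2C h : gmean2 N h = gmean2 N (fun y1 y2 => h y2 y1).
Proof.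
by rewrite /gmean2 /gmean -!mulr_sumr exchange_big/= mulr_sumr.
Qed.

Lemma gmean2D h g :
  gmean2 N (fun y1 y2 => h y1 y2 + g y1 y2) = gmean2 N h + gmean2 N g.
Proof. by rewrite /gmean2 -gmeanD; apply: eq_gmean => y1; rewrite gmeanD. Qed.

Lemma gmean2Z c h : gmean2 N (fun y1 y2 => c * h y1 y2) = c * gmean2 N h.
Proof. by rewrite /gmean2 -gmeanZ; apply: eq_gmean => y1; rewrite gmeanZ. Qed.

Lemma gmean2_sum (I : Type) (r : seq I) (P : pred I) (F : I -> R -> R -> R) :
  gmean2 N (fun y1 y2 => \sum_(i <- r | P i) F i y1 y2) = \sum_(i <- r | P i) gmean2 N (F i).
Proof. by rewrite /gmean2 -gmean_sum; apply: eq_gmean => y1; rewrite gmean_sum. Qed.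

Lemma ler_gmean2 h g : (forall y1 y2, h y1 y2 <= g y1 y2) -> gmean2 N h <= gmean2 N g.
Proof. by move=> hg; apply: ler_gmean => y1; apply: ler_gmean => y2. Qed.

Lemma ler_norm_gmean2 h : `|gmean2 N h| <= gmean2 N (fun y1 y2 => `|h y1 y2|).
Proof.
by rewrite (le_trans (ler_norm_gmean _ _))//; apply: ler_gmean => y1; apply: ler_norm_gmean.
Qed.

Lemma gmean2M (f g : R -> R) : gmean2 N (fun y1 y2 => f y1 * g y2) = gmean N f * gmean N g.
Proof. by rewrite /gmean2 -gmeanZr; apply: eq_gmean => y1; rewrite gmeanZ. Qed.

End GridMean2.

(** A distance on the torus R^2 / Z^2 that needs no reduction modulo 1: [|sin (pi * x)|] has period
    1, is subadditive, and is comparable to the distance from x to the nearest integer. *)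
Definition tdist {R : realType} (p1 p2 q1 q2 : R) : R :=
  `|sin (pi * (p1 - q1))| + `|sin (pi * (p2 - q2))|.

(* Fejer mean of order [L] of [h], with the convolution integral sampled on the grid. *)
Definition samp {R : realType} (L N : nat) (h : R -> R -> R) (p1 p2 : R) : R :=
  gmean2 N (fun y1 y2 => h y1 y2 * (fej L (p1 - y1) * fej L (p2 - y2))).

Definition hhat {R : realType} (N : nat) (h : R -> R -> R) (a1 a2 : bool * nat) : R :=
  gmean2 N (fun y1 y2 => h y1 y2 * (tg a1 y1 * tg a2 y2)).

Section Sampling.
Context {R : realType} (L N : nat).
Hypotheses (L1 : (1 < L)%N) (LN : (L < N)%N).
Implicit Type h : R -> R -> R.

Lemma gmean2_fej (p1 p2 : R) : gmean2 N (fun y1 y2 => fej L (p1 - y1) * fej L (p2 - y2)) = 1.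
Proof. by rewrite gmean2M !gmean_fej ?mulr1// (ltnW L1) (ltnW LN). Qed.

Lemma samp_le1 h p1 p2 : (forall y1 y2, 0 <= h y1 y2 <= 1) -> `|samp L N h p1 p2| <= 1.
Proof.
move=> h01; rewrite -[leRHS](gmean2_fej p1 p2) (le_trans (ler_norm_gmean2 _ _))//.
apply: ler_gmean2 => y1 y2; have /andP[h0 h1] := h01 y1 y2.
by rewrite ger0_norm ?mulr_ge0 ?fej_ge0// ler_piMl// mulr_ge0 ?fej_ge0.
Qed.

(** The inequality |x| <= e/2 + x^2 / (2e) trades the distance for its square, whose mean against
    the kernel is known exactly. Each coordinate contributes e/2 + 1 / (4 L e). *)
Lemma samp_close h (K e : R) p1 p2 : 0 <= K -> 0 < e ->
  (forall q1 q2, `|h q1 q2 - h p1 p2| <= K * tdist p1 p2 q1 q2) ->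
  `|samp L N h p1 p2 - h p1 p2| <= K * (e + (2 * L%:R * e)^-1).
Proof.
move=> K0 e0 hK; have LL : L%:R != 0 :> R by rewrite pnatr_eq0 -lt0n ltnW.
pose f1 y := fej L (p1 - y); pose f2 y := fej L (p2 - y).
have -> : samp L N h p1 p2 - h p1 p2 = gmean2 N (fun y1 y2 => (h y1 y2 - h p1 p2) * (f1 y1 * f2 y2)).
  rewrite -[X in _ - X]mulr1 -(gmean2_fej p1 p2) -mulNr -gmean2Z /samp -gmean2D.
  by apply: eq_gmean2 => y1 y2; rewrite -mulrDl.
apply: (le_trans (ler_norm_gmean2 _ _)).
pose s1 y := sin (pi * (p1 - y)) ^+ 2; pose s2 y := sin (pi * (p2 - y)) ^+ 2.
apply: (@le_trans _ _ (gmean2 N (fun y1 y2 => K * e * (f1 y1 * f2 y2) +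
   (K / (2 * e) * ((f1 y1 * s1 y1) * f2 y2) + K / (2 * e) * (f1 y1 * (f2 y2 * s2 y2)))))).
  apply: ler_gmean2 => y1 y2.
  have f0 : 0 <= f1 y1 * f2 y2 by rewrite mulr_ge0 ?fej_ge0.
  rewrite normrM (ger0_norm f0).
  have am (x : R) : `|x| <= e / 2 + x ^+ 2 / (2 * e).
    have : 0 <= (`|x| - e) ^+ 2 / (2 * e) by rewrite divr_ge0 ?sqr_ge0// mulr_ge0// ltW.
    rewrite -(real_normK (num_real x)).
    have -> : (`|x| - e) ^+ 2 / (2 * e) = e / 2 + `|x| ^+ 2 / (2 * e) - `|x|.
      by field; rewrite gt_eqF.
    by rewrite subr_ge0.
  have H : `|h y1 y2 - h p1 p2| <= K * (e + (s1 y1 + s2 y2) / (2 * e)).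
    apply: (le_trans (hK _ _)); apply: ler_wpM2l => //.
    have := am (sin (pi * (p1 - y1))); have := am (sin (pi * (p2 - y2))).
    by rewrite /tdist /s1 /s2 mulrDl; lra.
  apply: (le_trans (ler_wpM2r f0 H)); rewrite le_eqVlt; apply/orP; left; apply/eqP; ring.
rewrite gmean2D gmean2D !gmean2Z gmean2_fej.
have -> : gmean2 N (fun y1 y2 => f1 y1 * s1 y1 * f2 y2) = (2 * L%:R)^-1.
  by rewrite gmean2M /f1 /s1 gmean_fej_sin2 ?L1// gmean_fej ?mulr1// (ltnW L1) (ltnW LN).
have -> : gmean2 N (fun y1 y2 => f1 y1 * (f2 y2 * s2 y2)) = (2 * L%:R)^-1.
  by rewrite gmean2M /f2 /s2 gmean_fej_sin2 ?L1// gmean_fej ?mul1r// (ltnW L1) (ltnW LN).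
by rewrite le_eqVlt; apply/orP; left; apply/eqP; field; rewrite LL gt_eqF.
Qed.

Lemma fej_tg (p y : R) : fej L (p - y) =
  \sum_(a : bool * 'I_L) fejc L a.2 * (tg (ix a) p * tg (ix a) y).
Proof.
rewrite -(pair_big xpredT xpredT
  (fun b k => fejc L (nat_of_ord k) * (tg (b, nat_of_ord k) p * tg (b, nat_of_ord k) y)))/=.
rewrite big_bool/= -big_split/=; apply: eq_bigr => k _.
by rewrite /tg/= -mulrDr mulrBr cosB addrC.
Qed.

(** The addition formula separates [p] from [y] in the kernel. The sampled mean is thus a
    trigonometric polynomial in [p], which a measure sees only through its Fourier coefficients. *)
Lemma samp_expand h p1 p2 : samp L N h p1 p2 =
  \sum_(a1 : bool * 'I_L) \sum_(a2 : bool * 'I_L)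
    fejc L a1.2 * fejc L a2.2 * hhat N h (ix a1) (ix a2) * (tg (ix a1) p1 * tg (ix a2) p2).
Proof.
rewrite /samp (@eq_gmean2 _ _ _ (fun y1 y2 =>
  \sum_(a1 : bool * 'I_L) \sum_(a2 : bool * 'I_L)
    fejc L a1.2 * fejc L a2.2 * (tg (ix a1) p1 * tg (ix a2) p2)
    * (h y1 y2 * (tg (ix a1) y1 * tg (ix a2) y2)))).
  rewrite gmean2_sum; apply: eq_bigr => a1 _; rewrite gmean2_sum; apply: eq_bigr => a2 _.
  by rewrite gmean2Z -/(hhat _ _ _ _); ring.
move=> y1 y2; rewrite !fej_tg mulr_suml mulr_sumr; apply: eq_bigr => a1 _.
by rewrite mulr_sumr mulr_sumr; apply: eq_bigr => a2 _; ring.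
Qed.

End Sampling.

(** * Bessel's inequality and dyadic energies in two variables *)

Section Bessel2.
Context {R : realType}.
Implicit Type h : R -> R -> R.

Lemma hhatC N h a1 a2 : hhat N h a1 a2 = hhat N (fun y1 y2 => h y2 y1) a2 a1.
Proof. by rewrite /hhat gmean2C; apply: eq_gmean2 => y1 y2; rewrite (mulrC (tg a1 _)). Qed.

Lemma bessel2 (L N : nat) h : (0 < N)%N -> (L + L <= N)%N ->
  \sum_(a1 : bool * 'I_L) \sum_(a2 : bool * 'I_L) hhat N h (ix a1) (ix a2) ^+ 2
    <= gmean2 N (fun y1 y2 => h y1 y2 ^+ 2).
Proof.
move=> N0 LN; pose F a1 y2 := gmean N (fun y1 => h y1 y2 * tg a1 y1).
have E a1 a2 : hhat N h a1 a2 = gmean N (fun y2 => F a1 y2 * tg a2 y2).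
  rewrite /hhat gmean2C; apply: eq_gmean => y1; rewrite -gmeanZr.
  by apply: eq_gmean => y2; rewrite mulrA.
apply: (@le_trans _ _ (\sum_(a1 : bool * 'I_L) gmean N (fun y2 => F (ix a1) y2 ^+ 2))).
  apply: ler_sum => a1 _; under eq_bigr do rewrite E.
  exact: bessel.
rewrite -gmean_sum gmean2C; apply: ler_gmean => y2; exact: bessel.
Qed.

Lemma tgD1 (a : bool * nat) (t : R) : tg a (t + 1) = tg a t.
Proof.
rewrite /tg; have -> : 2 * pi * a.2%:R * (t + 1) = 2 * pi * a.2%:R * t + pi *+ 2 *+ a.2.
  by rewrite mulrDr mulr1 -[in RHS]mulr_natr -[in RHS]mulr_natr; congr (_ + _); ring.
case: a.1; first by rewrite (periodicn (@sinD2pi R)).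
by rewrite (periodicn (@cosD2pi R)).
Qed.

Definition shift1 (z : R) h : R -> R -> R := fun y1 y2 => h (y1 + z) y2 - h y1 y2.

(** Translation by a grid point rotates the pair of cosine and sine coefficients by an angle theta,
    so the increment multiplies its squared length by |e^(i theta) - 1|^2 = 2 (1 - cos theta). *)
Lemma hhat_shift (N d k : nat) h (a : bool * nat) : (0 < N)%N ->
  (forall y1 y2, h (y1 + 1) y2 = h y1 y2) ->
  hhat N (shift1 (d%:R / N%:R) h) (false, k) a ^+ 2 + hhat N (shift1 (d%:R / N%:R) h) (true, k) a ^+ 2
  = 2 * (1 - cos (2 * pi * k%:R * (d%:R / N%:R)))
    * (hhat N h (false, k) a ^+ 2 + hhat N h (true, k) a ^+ 2).
Proof.
move=> N0 hp; set z := d%:R / N%:R; set th := 2 * pi * k%:R * z.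
have S (b : bool) : hhat N (shift1 z h) (b, k) a =
    gmean2 N (fun y1 y2 => h y1 y2 * (tg (b, k) (y1 - z) * tg a y2)) - hhat N h (b, k) a.
  rewrite -[- hhat _ _ _ _]mulN1r -gmean2Z /hhat gmean2C [in RHS]gmean2C [X in _ = _ + X]gmean2C.
  rewrite -gmean2D; apply: eq_gmean => y2; rewrite [RHS]gmeanD.
  rewrite -[X in _ = X + _](gmean_shift N0 d).
    by rewrite -gmeanD; apply: eq_gmean => y1; rewrite addrK /shift1; ring.
  by move=> t; rewrite hp (_ : t + 1 - z = t - z + 1) ?tgD1//; ring.
set A := hhat N h (false, k) a; set B := hhat N h (true, k) a.
have EA : hhat N (shift1 z h) (false, k) a = (cos th - 1) * A + sin th * B.
  rewrite S -/A mulrBl mul1r addrAC /A /B; congr (_ - _); rewrite -!gmean2Z -gmean2D.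
  by apply: eq_gmean2 => y1 y2; rewrite /tg/= mulrBr cosB /th; ring.
have EB : hhat N (shift1 z h) (true, k) a = (cos th - 1) * B - sin th * A.
  rewrite S -/B mulrBl mul1r addrAC /A /B; congr (_ - _).
  rewrite -[- (sin th * _)]mulNr -!gmean2Z -gmean2D.
  by apply: eq_gmean2 => y1 y2; rewrite /tg/= mulrBr sinB /th; ring.
rewrite EA EB.
have -> : ((cos th - 1) * A + sin th * B) ^+ 2 + ((cos th - 1) * B - sin th * A) ^+ 2 =
  (cos th ^+ 2 + sin th ^+ 2 + 1 - 2 * cos th) * (A ^+ 2 + B ^+ 2) by ring.
by rewrite cos2Dsin2; ring.
Qed.

Lemma cos_le0 (x : R) : pi / 2 <= x <= pi -> cos x <= 0.
Proof.
move=> /andP[x1 x2]; rewrite -[x](subrK (pi / 2)) cosDpihalf oppr_le0.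
by apply: sin_ge0_pi; have := @pi_ge0 R; lra.
Qed.

(* A shift by [2^-(j+2)] rotates the frequencies of the dyadic block [2^j, 2^(j+1)) by
   an angle in [pi/2, pi], so that [|e^(i theta) - 1|^2 >= 2] there. *)
Lemma block_energy (M j : nat) h : (j < M)%N ->
  (forall y1 y2, h (y1 + 1) y2 = h y1 y2) ->
  \sum_(a1 : bool * 'I_(2 ^ M) | (2 ^ j <= a1.2 < 2 ^ j.+1)%N) \sum_(a2 : bool * 'I_(2 ^ M))
     hhat (2 ^ M.+1) h (ix a1) (ix a2) ^+ 2
  <= 2^-1 * gmean2 (2 ^ M.+1) (fun y1 y2 => shift1 (2 ^- j.+2) h y1 y2 ^+ 2).
Proof.
move=> jM hp; set N := (2 ^ M.+1)%N; have N0 : (0 < N)%N by rewrite expn_gt0.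
have Nn : N%:R != 0 :> R by rewrite pnatr_eq0 -lt0n.
(* The shift 2^-(j+2) must be a multiple [d / N] of the grid step; this is possible because
   [j < M]. *)
pose d := (2 ^ (M.-1 - j))%N.
have zE : 2 ^- j.+2 = d%:R / N%:R :> R.
  have -> : N%:R = d%:R * 2 ^+ j.+2 :> R.
    by rewrite /N /d -natrX -natrM -expnD; congr (_ ^ _)%:R; lia.
  by rewrite [in RHS]invfM mulrA [in RHS]mulfV ?mul1r// pnatr_eq0 -lt0n expn_gt0.
rewrite zE; set h' := shift1 _ _.
have LN : (2 ^ M + 2 ^ M <= N)%N by rewrite /N expnS mul2n addnn.
have := bessel2 h' N0 LN; rewrite -(ler_pM2l (_ : 0 < 2^-1)) ?invr_gt0//.
apply: le_trans; rewrite mulr_sumr.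
rewrite -[leLHS](pair_big_dep xpredT (fun (b : bool) (k : 'I_(2 ^ M)) => (2 ^ j <= k < 2 ^ j.+1)%N)
   (fun b k => \sum_(a2 : bool * 'I_(2 ^ M)) hhat N h (b, nat_of_ord k) (ix a2) ^+ 2))/=.
rewrite -[leRHS](pair_big_dep xpredT (fun (b : bool) (k : 'I_(2 ^ M)) => true)
   (fun b k => 2^-1 * \sum_(a2 : bool * 'I_(2 ^ M)) hhat N h' (b, nat_of_ord k) (ix a2) ^+ 2))/=.
rewrite !big_bool/= -!big_split/= big_mkcond; apply: ler_sum => k _.
rewrite -mulrDr -!big_split/=; case: ifP => [/andP[k1 k2]|_]; last first.
  by rewrite mulr_ge0 ?invr_ge0//; apply: sumr_ge0 => a _; rewrite addr_ge0 ?sqr_ge0.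
rewrite mulr_sumr; apply: ler_sum => a _.
rewrite addrC [X in _ <= _ * X]addrC hhat_shift//.
set S := _ + _; have S0 : 0 <= S by rewrite addr_ge0 ?sqr_ge0.
set th := (X in cos X); suff : cos th <= 0 by nra.
have k1R : 2 ^+ j <= k%:R :> R by rewrite -natrX ler_nat.
have k2R : k%:R <= 2 * 2 ^+ j :> R by rewrite -exprS -natrX ler_nat ltnW.
have p0 := @pi_gt0 R; have j0 : 0 < 2 ^+ j :> R by rewrite exprn_gt0.
apply: cos_le0; rewrite /th -zE !exprS.
have -> : 2 * pi * k%:R / (2 * (2 * 2 ^+ j)) = (pi / 2) * (k%:R / 2 ^+ j) :> R.
  by field; rewrite gt_eqF.
have q1 : 1 <= k%:R / 2 ^+ j :> R by rewrite ler_pdivlMr ?mul1r.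
have q2 : k%:R / 2 ^+ j <= 2 :> R by rewrite ler_pdivrMr.
by apply/andP; split; nra.
Qed.

End Bessel2.

Lemma sum_ord_between (L m n : nat) : (\sum_(k < L | (m <= k < n)%N) 1 <= n - m)%N.
Proof.
apply: (@leq_trans (minn L n - m)); last by lia.
elim: L => [|L IH]; first by rewrite big_ord0.
rewrite big_mkcond big_ord_recr/= -big_mkcond/=; move: IH; set S := bigop _ _ _.
by case: ifP; lia.
Qed.

Lemma sum_freq_between (R : realType) (L m n : nat) :
  \sum_(a : bool * 'I_L | (m <= a.2 < n)%N) 1 <= 2 * (n - m)%:R :> R.
Proof.
rewrite -[leLHS](pair_big_dep xpredT (fun (b : bool) (k : 'I_L) => (m <= k < n)%N) (fun _ _ => 1))/=.
rewrite big_bool/=; set S := bigop _ _ _; have -> : S + S = 2 * S by ring.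
rewrite ler_pM2l ?ltr0n// /S; have := sum_ord_between L m n; rewrite -(ler_nat R); apply: le_trans.
by rewrite natr_sum.
Qed.

(** * Summation of the coefficients of [h] against coefficients with decay of order one *)

Section MainSum.
Context {R : realType} (M : nat) (al si C : R).
Hypotheses (al0 : 0 < al) (si0 : 0 < si) (si1 : si < 1) (C0 : 0 <= C).
Let L := (2 ^ M)%N.
Let N := (2 ^ M.+1)%N.
Implicit Type h : R -> R -> R.

Let w (k l : nat) : R := (1 + k%:R + l%:R)^-1.

(** The weight is at most 2^-j on the block, and its square sums to a constant over the roughly 4^j
    pairs. The result is therefore the square root of the energy up to a constant, with no loss in
    [j]. *)
Lemma block_sum (j : nat) h : (j < M)%N ->
  (forall y1 y2, h (y1 + 1) y2 = h y1 y2) ->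
  gmean2 N (fun y1 y2 => shift1 (2 ^- j.+2) h y1 y2 ^+ 2) <= al ^+ 2 * si ^+ (2 * j) ->
  \sum_(a1 : bool * 'I_L | (2 ^ j <= a1.2 < 2 ^ j.+1)%N) \sum_(a2 : bool * 'I_L | (a2.2 <= a1.2)%N)
     `|hhat N h (ix a1) (ix a2)| * w a1.2 a2.2 <= 5 * (al * si ^+ j).
Proof.
move=> jM hp hE; set la := al * si ^+ j; have la0 : 0 < la by rewrite mulr_gt0// exprn_gt0.
pose K : R := 2 ^+ j; have K0 : 0 < K by rewrite exprn_gt0.
have la2 : al ^+ 2 * si ^+ (2 * j) = la ^+ 2 by rewrite /la exprMn -exprM mulnC.
(* AM-GM: [|x| / K <= x^2 / (2 la) + la / (2 K^2)], summed over at most 8 K^2 frequencies *)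
have am (a1 a2 : bool * 'I_L) : (2 ^ j <= a1.2)%N ->
   `|hhat N h (ix a1) (ix a2)| * w a1.2 a2.2
     <= (2 * la)^-1 * hhat N h (ix a1) (ix a2) ^+ 2 + la / (2 * K ^+ 2).
  move=> ja; set x := hhat _ _ _ _.
  have wK : w a1.2 a2.2 <= K^-1.
    have w0 : 0 < 1 + a1.2%:R + a2.2%:R :> R by rewrite ltr_wpDr// ltr_wpDr.
    rewrite /w lef_pV2 ?posrE//.
    have : K <= a1.2%:R by rewrite /K -natrX ler_nat.
    have : 0 <= a2.2%:R :> R by [].
    lra.
  apply: (le_trans (ler_wpM2l (normr_ge0 _) wK)).
  have : 0 <= (`|x| / la - K^-1) ^+ 2 * (la / 2).
    by rewrite mulr_ge0 ?sqr_ge0// divr_ge0// ltW.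
  have -> : (`|x| / la - K^-1) ^+ 2 * (la / 2) = (2 * la)^-1 * `|x| ^+ 2 + la / (2 * K ^+ 2) - `|x| / K.
    by field; rewrite !gt_eqF.
  by rewrite real_normK ?num_real// subr_ge0.
apply: (@le_trans _ _ (\sum_(a1 : bool * 'I_L | (2 ^ j <= a1.2 < 2 ^ j.+1)%N)
   ((2 * la)^-1 * \sum_(a2 : bool * 'I_L) hhat N h (ix a1) (ix a2) ^+ 2
    + (la / (2 * K ^+ 2)) * \sum_(a2 : bool * 'I_L | (0 <= a2.2 < 2 ^ j.+1)%N) 1))).
  apply: ler_sum => a1 /andP[ja1 a1j].
  apply: (@le_trans _ _ (\sum_(a2 : bool * 'I_L | (a2.2 <= a1.2)%N)
     ((2 * la)^-1 * hhat N h (ix a1) (ix a2) ^+ 2 + la / (2 * K ^+ 2)))).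
    by apply: ler_sum => a2 _; exact: am.
  rewrite big_split/= !mulr_sumr lerD//.
    rewrite big_mkcond; apply: ler_sum => a2 _; case: ifP => // _.
    by rewrite mulr_ge0 ?sqr_ge0// invr_ge0 mulr_ge0// ltW.
  rewrite big_mkcond [leRHS]big_mkcond; apply: ler_sum => a2 _; rewrite mulr1.
  case: ifP => [h21|_]; first by rewrite (leq_ltn_trans h21 a1j).
  by case: ifP => // _; rewrite divr_ge0 ?(ltW la0)// mulr_ge0// sqr_ge0.
rewrite big_split/= -mulr_sumr.
have B1 := block_energy jM hp.
have B2 : \sum_(a1 : bool * 'I_L | (2 ^ j <= a1.2 < 2 ^ j.+1)%N) \sum_(a2 : bool * 'I_L)
     hhat N h (ix a1) (ix a2) ^+ 2 <= 2^-1 * la ^+ 2.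
  by apply: (le_trans B1); rewrite -la2 ler_pM2l.
have B3 : \sum_(a2 : bool * 'I_L | (0 <= a2.2 < 2 ^ j.+1)%N) 1 <= 4 * K.
  have := sum_freq_between R L 0 (2 ^ j.+1); rewrite subn0 natrX exprS -/K.
  by move/le_trans; apply; rewrite mulrA -natrM.
have B4 : \sum_(a1 : bool * 'I_L | (2 ^ j <= a1.2 < 2 ^ j.+1)%N) 1 <= 2 * K.
  have := sum_freq_between R L (2 ^ j) (2 ^ j.+1).
  by rewrite expnS mul2n -addnn addnK natrX -/K.
have c0 : 0 <= la / (2 * K ^+ 2) by rewrite divr_ge0 ?(ltW la0)// mulr_ge0// sqr_ge0.
have T2 : \sum_(a1 : bool * 'I_L | (2 ^ j <= a1.2 < 2 ^ j.+1)%N)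
     (la / (2 * K ^+ 2) * \sum_(a2 : bool * 'I_L | (0 <= a2.2 < 2 ^ j.+1)%N) 1)
   <= la / (2 * K ^+ 2) * (4 * K) * (2 * K).
  apply: (@le_trans _ _ (\sum_(a1 : bool * 'I_L | (2 ^ j <= a1.2 < 2 ^ j.+1)%N)
      la / (2 * K ^+ 2) * (4 * K) * 1)).
    by apply: ler_sum => a _; rewrite mulr1; exact: ler_wpM2l.
  by rewrite -mulr_sumr; apply: ler_wpM2l => //; rewrite mulr_ge0// mulr_ge0// ltW.
have T1 := ler_wpM2l (_ : 0 <= (2 * la)^-1) B2.
apply: (le_trans (lerD (T1 _) T2)); first by rewrite invr_ge0 mulr_ge0// ltW.
(* The energy contributes 1/4 and the number of pairs 4; the constant 5 rounds up their sum. *)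
have -> : (2 * la)^-1 * (2^-1 * la ^+ 2) + la / (2 * K ^+ 2) * (4 * K) * (2 * K)
  = 5 * la - 4^-1 * 3 * la.
  by field; rewrite !gt_eqF.
by lra.
Qed.

Lemma geometric_le (n : nat) : \sum_(j < n) si ^+ j <= (1 - si)^-1.
Proof.
rewrite -[leRHS]mul1r ler_pdivlMr ?subr_gt0// mulrC.
have := subrX1 si n; rewrite -(opprB 1 si) mulNr => /(canLR (@opprK _)) <-.
by rewrite opprB gerBl exprn_ge0// ltW.
Qed.

(** The integer part of log_2 of the first frequency sorts the terms into dyadic blocks, whose
    bounds form a geometric series of ratio [si]. *)
Lemma half_sum h :
  (forall y1 y2, h (y1 + 1) y2 = h y1 y2) ->
  (forall j, (j < M)%N ->
    gmean2 N (fun y1 y2 => shift1 (2 ^- j.+2) h y1 y2 ^+ 2) <= al ^+ 2 * si ^+ (2 * j)) ->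
  \sum_(a1 : bool * 'I_L | (0 < a1.2)%N) \sum_(a2 : bool * 'I_L | (a2.2 <= a1.2)%N)
     `|hhat N h (ix a1) (ix a2)| * w a1.2 a2.2 <= 5 * al / (1 - si).
Proof.
move=> hp hE.
pose F (a1 : bool * 'I_L) := \sum_(a2 : bool * 'I_L | (a2.2 <= a1.2)%N)
     `|hhat N h (ix a1) (ix a2)| * w a1.2 a2.2.
have F0 a : 0 <= F a.
  by rewrite sumr_ge0// => i _; rewrite mulr_ge0// invr_ge0 !addr_ge0.
rewrite -/(F _).
apply: (@le_trans _ _ (\sum_(j < M) \sum_(a1 : bool * 'I_L | (2 ^ j <= a1.2 < 2 ^ j.+1)%N) F a1)).
  under [leRHS]eq_bigr do rewrite big_mkcond.
  rewrite exchange_big/= big_mkcond; apply: ler_sum => a _.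
  case: ifP => [a0|_]; last by rewrite sumr_ge0// => j _; case: ifP.
  have /andP[t1 t2] := trunc_log_bounds (isT : (1 < 2)%N) a0.
  have tM : (trunc_log 2 a.2 < M)%N.
    by rewrite -(ltn_exp2l _ _ (isT : (1 < 2)%N)) (leq_ltn_trans t1)// ltn_ord.
  rewrite (bigD1 (Ordinal tM))//= t1 t2/= lerDl sumr_ge0// => j _; case: ifP => //.
apply: (@le_trans _ _ (\sum_(j < M) 5 * (al * si ^+ j))).
  by apply: ler_sum => j _; apply: block_sum => //; exact: hE.
rewrite -!mulr_sumr mulrA ler_pM2l; first exact: geometric_le.
by rewrite mulr_gt0.
Qed.

(** Either both frequencies are zero, or the first is positive and dominates, or the second does;
    the last case is the second one with the variables of [h] exchanged. The constant is 56 = 4 (4 +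
    5 + 5): a factor 4 from the two Fejer coefficients, then four sine-cosine pairs of frequency
    zero and two half sums. *)
Lemma main_sum h (G : bool * nat -> bool * nat -> R) :
  (forall y1 y2, h (y1 + 1) y2 = h y1 y2) ->
  (forall y1 y2, h y1 (y2 + 1) = h y1 y2) ->
  (forall y1 y2, 0 <= h y1 y2) ->
  gmean2 N h <= al ->
  (forall j, (j < M)%N ->
    gmean2 N (fun y1 y2 => shift1 (2 ^- j.+2) h y1 y2 ^+ 2) <= al ^+ 2 * si ^+ (2 * j)) ->
  (forall j, (j < M)%N ->
    gmean2 N (fun y1 y2 => shift1 (2 ^- j.+2) (fun z1 z2 => h z2 z1) y1 y2 ^+ 2)
      <= al ^+ 2 * si ^+ (2 * j)) ->
  (forall a1 a2, `|G a1 a2| <= C / (1 + a1.2%:R + a2.2%:R)) ->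
  `|\sum_(a1 : bool * 'I_L) \sum_(a2 : bool * 'I_L)
    fejc L a1.2 * fejc L a2.2 * hhat N h (ix a1) (ix a2) * G (ix a1) (ix a2)|
  <= 56 * C * al / (1 - si).
Proof.
move=> hp1 hp2 h0 hm hE1 hE2 hG.
pose X (a1 a2 : bool * 'I_L) := `|hhat N h (ix a1) (ix a2)| * w a1.2 a2.2.
have X0 a1 a2 : 0 <= X a1 a2 by rewrite mulr_ge0// invr_ge0 !addr_ge0.
have S1 : \sum_(a1 : bool * 'I_L) \sum_(a2 : bool * 'I_L) X a1 a2 <=
    4 * al + 5 * al / (1 - si) + 5 * al / (1 - si).
  apply: (@le_trans _ _ (\sum_(a1 : bool * 'I_L) \sum_(a2 : bool * 'I_L)
    ((if (a1.2 == 0 :> nat) && (a2.2 == 0 :> nat) then X a1 a2 else 0) +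
     (if (0 < a1.2)%N && (a2.2 <= a1.2)%N then X a1 a2 else 0) +
     (if (0 < a2.2)%N && (a1.2 <= a2.2)%N then X a1 a2 else 0)))).
    apply: ler_sum => a1 _; apply: ler_sum => a2 _; have := X0 a1 a2.
    case: (posnP a1.2) => [->|p1]; case: (posnP a2.2) => [->|p2];
      rewrite ?(gtn_eqF p1) ?(gtn_eqF p2)/= ?add0r ?addr0//.
    by case/orP: (leq_total a1.2 a2.2) => -> X0'; case: ifP => _; rewrite ?lerDl ?lerDr.
  under eq_bigr do rewrite big_split big_split/=.
  rewrite !big_split/=; apply: lerD; first apply: lerD.
  - apply: (@le_trans _ _ (\sum_(a1 : bool * 'I_L | (0 <= a1.2 < 1)%N)
        al * \sum_(a2 : bool * 'I_L | (0 <= a2.2 < 1)%N) 1)).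
      rewrite [leRHS]big_mkcond; apply: ler_sum => a1 _; rewrite leq0n ltnS leqn0/=.
      case: eqP => /= [a10|_]; last by rewrite big1.
      rewrite mulr_sumr [leRHS]big_mkcond; apply: ler_sum => a2 _; rewrite ltnS leqn0/=.
      case: eqP => //= a20; rewrite mulr1 (le_trans _ hm)// /X a10 a20 /w !addr0 invr1 mulr1.
      apply: (le_trans (ler_norm_gmean2 _ _)); apply: ler_gmean2 => y1 y2.
      rewrite normrM (ger0_norm (h0 _ _)) ler_piMr// normrM.
      by rewrite mulr_ile1// normr_tg.
    have Z := sum_freq_between R L 0 1; rewrite subn0 mulr1 in Z.
    apply: (@le_trans _ _ (\sum_(a1 : bool * 'I_L | (0 <= a1.2 < 1)%N) (al * 2) * 1)).
      by apply: ler_sum => a _; rewrite mulr1 ler_pM2l.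
    by rewrite -mulr_sumr; have := al0; nra.
  - have := half_sum hp1 hE1; rewrite big_mkcond/=; apply: le_trans.
    apply: ler_sum => a1 _; case: ifP => _/=; last by rewrite big1.
    by rewrite -big_mkcond.
  - have := half_sum (h := fun z1 z2 => h z2 z1) (fun y1 y2 => hp2 y2 y1) hE2.
    rewrite big_mkcond/= exchange_big/=; apply: le_trans.
    apply: ler_sum => a1 _; case: ifP => _/=; last by rewrite big1.
    rewrite -big_mkcond; apply: ler_sum => a2 _; rewrite /X hhatC ler_wpM2l//.
    by rewrite /w addrAC.
have S2 : `|\sum_(a1 : bool * 'I_L) \sum_(a2 : bool * 'I_L)
    fejc L a1.2 * fejc L a2.2 * hhat N h (ix a1) (ix a2) * G (ix a1) (ix a2)| <=
   4 * C * \sum_(a1 : bool * 'I_L) \sum_(a2 : bool * 'I_L) X a1 a2.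
  rewrite (le_trans (ler_norm_sum _ _ _))// mulr_sumr; apply: ler_sum => a1 _.
  rewrite (le_trans (ler_norm_sum _ _ _))// mulr_sumr; apply: ler_sum => a2 _.
  have aux (f1 f2 x g q : R) : 0 <= f1 <= 2 -> 0 <= f2 <= 2 -> 0 <= q -> `|g| <= C * q ->
      `|f1 * f2 * x * g| <= 4 * C * (`|x| * q).
    move=> /andP[f10 f12] /andP[f20 f22] q0 gq.
    rewrite !normrM (ger0_norm f10) (ger0_norm f20).
    have -> : 4 * C * (`|x| * q) = 2 * 2 * `|x| * (C * q) by ring.
    by do !apply: ler_pM => //; rewrite !mulr_ge0.
  apply: (aux _ _ (hhat N h (ix a1) (ix a2)) _ (w a1.2 a2.2)); last exact: hG.
  - by rewrite fejc_ge0 ?fejc_le2//; exact: ltn_ord.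
  - by rewrite fejc_ge0 ?fejc_le2//; exact: ltn_ord.
  - by rewrite invr_ge0 !addr_ge0.
apply: (le_trans S2); apply: (le_trans (ler_wpM2l _ S1)); first by rewrite mulr_ge0.
have i1 : 1 <= (1 - si)^-1 by rewrite invf_ge1 ?subr_gt0// gerBl ltW.
set q := (1 - si)^-1 in i1 *.
have : 0 <= C * al * (q - 1) by rewrite mulr_ge0 ?mulr_ge0 ?subr_ge0// ltW.
by lra.
Qed.

End MainSum.

(** * Bumps on the torus *)

Definition tbump {R : realType} (r c1 c2 p1 p2 : R) : R :=
  Num.min 1 (Num.max 0 (2 - tdist p1 p2 c1 c2 / r)).

Section Bump.
Context {R : realType}.
Implicit Types r c p q : R.

Lemma tdistC p1 p2 q1 q2 : tdist p1 p2 q1 q2 = tdist q1 q2 p1 p2.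
Proof.
have E (x y : R) : `|sin (pi * (x - y))| = `|sin (pi * (y - x))|.
  by rewrite -normrN -sinN -mulrN opprB.
by rewrite /tdist E (E p2).
Qed.

Lemma tdist_swap p1 p2 q1 q2 : tdist p1 p2 q1 q2 = tdist p2 p1 q2 q1.
Proof. exact: addrC. Qed.

Lemma tdist_triangle p1 p2 q1 q2 c1 c2 :
  tdist p1 p2 c1 c2 <= tdist p1 p2 q1 q2 + tdist q1 q2 c1 c2.
Proof.
rewrite /tdist addrACA; apply: lerD.
  by rewrite (_ : p1 - c1 = (p1 - q1) + (q1 - c1)) ?mulrDr ?norm_sinD//; ring.
by rewrite (_ : p2 - c2 = (p2 - q2) + (q2 - c2)) ?mulrDr ?norm_sinD//; ring.
Qed.

Lemma tdistD1 p1 p2 q1 q2 : tdist (p1 + 1) p2 q1 q2 = tdist p1 p2 q1 q2.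
Proof.
rewrite /tdist (_ : pi * (p1 + 1 - q1) = pi * (p1 - q1) + pi); last by ring.
by rewrite sinDpi normrN.
Qed.

Lemma bump01 r c1 c2 p1 p2 : 0 <= tbump r c1 c2 p1 p2 <= 1.
Proof. by rewrite /tbump le_min ler01 le_max lexx/= ge_min lexx. Qed.

Lemma bump_swap r c1 c2 p1 p2 : tbump r c1 c2 p1 p2 = tbump r c2 c1 p2 p1.
Proof. by rewrite /tbump tdist_swap. Qed.

Lemma bumpD1 r c1 c2 p1 p2 : tbump r c1 c2 (p1 + 1) p2 = tbump r c1 c2 p1 p2.
Proof. by rewrite /tbump tdistD1. Qed.

Lemma bump_eq1 r c1 c2 p1 p2 : 0 < r -> tdist p1 p2 c1 c2 <= r -> tbump r c1 c2 p1 p2 = 1.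
Proof.
move=> r0 h; apply/min_idPl; rewrite le_max; apply/orP; right.
have : tdist p1 p2 c1 c2 / r <= 1 by rewrite ler_pdivrMr ?mul1r.
lra.
Qed.

Lemma bump_eq0 r c1 c2 p1 p2 : 0 < r -> 2 * r < tdist p1 p2 c1 c2 -> tbump r c1 c2 p1 p2 = 0.
Proof.
move=> r0 h; rewrite /tbump (_ : Num.max _ _ = 0) ?min_r//.
apply/max_idPl; rewrite subr_le0 ler_pdivlMr//; exact: ltW.
Qed.

Lemma ler_norm_max (a b A B : R) :
  `|Num.max a A - Num.max b B| <= Num.max `|a - b| `|A - B|.
Proof.
set m := Num.max `|_ - _| `|_ - _|.
have : `|a - b| <= m by rewrite le_max lexx.
have : `|A - B| <= m by rewrite le_max lexx orbT.
rewrite !ler_norml => /andP[? ?] /andP[? ?].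
by case: (leP a A) => ?; case: (leP b B) => ?; lra.
Qed.

Lemma bump_lip r c1 c2 p1 p2 q1 q2 : 0 < r ->
  `|tbump r c1 c2 p1 p2 - tbump r c1 c2 q1 q2| <= tdist p1 p2 q1 q2 / r.
Proof.
move=> r0; rewrite /tbump; set a := _ / r; set b := tdist q1 _ _ _ / r; set t := _ / r.
have h1 : a <= t + b by rewrite -mulrDl ler_pM2r ?invr_gt0// tdist_triangle.
have h2 : b <= t + a.
  by rewrite -mulrDl ler_pM2r ?invr_gt0// /a (tdistC p1 p2 q1 q2) tdist_triangle.
rewrite ler_norml.
by case: (leP 0 (2 - a)) => ?; case: (leP 0 (2 - b)) => ?; do ?[case: (leP 1 _) => ?]; lra.
Qed.

(** The increment vanishes unless the point or its translate lies in the support, hence the two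
    products of indicators. Its size is bounded trivially by 1 and by the Lipschitz estimate. *)
Lemma bump_shift_sqr r c1 c2 (z y1 y2 : R) : 0 < r -> 0 <= z ->
  shift1 z (tbump r c1 c2) y1 y2 ^+ 2 <= Num.min 1 (pi * z / r) ^+ 2 *
   ((((`|sin (pi * (c1 - y1))| <= 2 * r)%R : nat)%:R * ((`|sin (pi * (c2 - y2))| <= 2 * r)%R : nat)%:R)
   + (((`|sin (pi * (c1 - z - y1))| <= 2 * r)%R : nat)%:R
       * ((`|sin (pi * (c2 - y2))| <= 2 * r)%R : nat)%:R)).
Proof.
move=> r0 z0; rewrite /shift1; set m := Num.min _ _.
have m0 : 0 <= m by rewrite le_min ler01 divr_ge0 ?(ltW r0)// mulr_ge0// pi_ge0.
have I (x1 x2 : R) : tdist x1 x2 c1 c2 <= 2 * r ->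
   (`|sin (pi * (c1 - x1))| <= 2 * r) && (`|sin (pi * (c2 - x2))| <= 2 * r).
  by rewrite tdistC /tdist => h; apply/andP; split; apply: le_trans h; rewrite ?lerDl ?lerDr.
have -> : c1 - z - y1 = c1 - (y1 + z) by ring.
set B1 : R := (nat_of_bool _)%:R * _; set B2 : R := (nat_of_bool _)%:R * _.
have B10 : 0 <= B1 by rewrite mulr_ge0.
have B20 : 0 <= B2 by rewrite mulr_ge0.
have D : (tbump r c1 c2 (y1 + z) y2 - tbump r c1 c2 y1 y2) ^+ 2 <= m ^+ 2.
  rewrite -real_normK ?num_real// ler_pXn2r ?nnegrE// le_min; apply/andP; split.
    have /andP[u1 u2] := bump01 r c1 c2 (y1 + z) y2; have /andP[v1 v2] := bump01 r c1 c2 y1 y2.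
    by rewrite ler_norml; lra.
  apply: (le_trans (bump_lip _ _ _ _ _ _ r0)); rewrite ler_pM2r ?invr_gt0//.
  rewrite /tdist subrr mulr0 sin0 normr0 addr0 (_ : y1 + z - y1 = z); last by ring.
  by rewrite (le_trans (ler_norm_sin _))// ger0_norm// mulr_ge0// pi_ge0.
have [h1|h1] := leP (tdist y1 y2 c1 c2) (2 * r).
  apply: (le_trans D); rewrite -[leLHS]mulr1 ler_wpM2l ?sqr_ge0//.
  have /andP[i1 i2] := I _ _ h1.
  by rewrite (_ : B1 = 1) ?lerDl// /B1 i1 i2 mulr1.
have [h2|h2] := leP (tdist (y1 + z) y2 c1 c2) (2 * r).
  apply: (le_trans D); rewrite -[leLHS]mulr1 ler_wpM2l ?sqr_ge0//.
  have /andP[i1 i2] := I _ _ h2.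
  by rewrite (_ : B2 = 1) ?lerDr// /B2 i1 i2 mulr1.
by rewrite !bump_eq0// subrr expr0n/= mulr_ge0 ?sqr_ge0 ?addr_ge0.
Qed.

(** Each indicator has mean at most 8 (2r), each product of two at most 256 r^2, and there are two
    products. *)
Lemma bump_energy (N : nat) r c1 c2 (z : R) : (0 < N)%N -> 0 < r -> 0 <= z -> (4 * r)^-1 <= N%:R ->
  gmean2 N (fun y1 y2 => shift1 z (tbump r c1 c2) y1 y2 ^+ 2)
    <= 512 * (r * Num.min 1 (pi * z / r)) ^+ 2.
Proof.
move=> N0 r0 z0 rN.
apply: (le_trans (ler_gmean2 N (fun y1 y2 => bump_shift_sqr c1 c2 y1 y2 r0 z0))).
rewrite gmean2Z gmean2D !gmean2M.
have r20 : 0 < 2 * r by rewrite mulr_gt0.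
have rN' : (2 * (2 * r))^-1 <= N%:R by rewrite mulrA -natrM.
have k c := @gmean_sin_small R N c (2 * r) N0 r20 rN'.
have k0 c : 0 <= gmean N (fun y : R => ((`|sin (pi * (c - y))| <= 2 * r)%R : nat)%:R).
  by apply: gmean_ge0.
have := ler_pM (k0 c1) (k0 c2) (k c1) (k c2).
have := ler_pM (k0 (c1 - z)) (k0 c2) (k (c1 - z)) (k c2).
set m := Num.min _ _; move=> e1 e2.
rewrite (_ : 512 * (r * m) ^+ 2 = m ^+ 2 * (512 * r ^+ 2)); last by ring.
apply: ler_wpM2l; first exact: sqr_ge0.
apply: (le_trans (lerD e2 e1)).
by rewrite le_eqVlt; apply/orP; left; apply/eqP; ring.
Qed.

Lemma bump_mean (N : nat) r c1 c2 : (0 < N)%N -> 0 < r -> (4 * r)^-1 <= N%:R ->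
  gmean2 N (tbump r c1 c2) <= 256 * r ^+ 2.
Proof.
move=> N0 r0 rN.
have r20 : 0 < 2 * r by rewrite mulr_gt0.
have rN' : (2 * (2 * r))^-1 <= N%:R by rewrite mulrA -natrM.
have k c := @gmean_sin_small R N c (2 * r) N0 r20 rN'.
have k0 c : 0 <= gmean N (fun y : R => ((`|sin (pi * (c - y))| <= 2 * r)%R : nat)%:R).
  by apply: gmean_ge0.
apply: (@le_trans _ _ (8 * (2 * r) * (8 * (2 * r)))); last first.
  by rewrite le_eqVlt; apply/orP; left; apply/eqP; ring.
apply: le_trans (ler_pM (k0 c1) (k0 c2) (k c1) (k c2)).
rewrite -gmean2M; apply: ler_gmean2 => y1 y2.
have [h|h] := leP (tdist y1 y2 c1 c2) (2 * r); last by rewrite bump_eq0// mulr_ge0.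
have /andP[_] := bump01 r c1 c2 y1 y2; move/le_trans; apply.
move: h; rewrite tdistC /tdist => h.
by rewrite !(le_trans _ h) ?lerDl ?lerDr ?mulr1.
Qed.

(** The left side is at most pi^2 min(r, z)^2. The bound separates r^s, the cost of the ball in a
    Hausdorff sum, from a power of the scale z that is positive because s < 2. *)
Lemma scale_le (s r z : R) : 0 <= s < 2 -> 0 < r -> 0 < z ->
  (r * Num.min 1 (pi * z / r)) ^+ 2 <= pi ^+ 2 * (r `^ s * z `^ (2 - s)).
Proof.
move=> /andP[s0 s2] r0 z0.
have p1 : 1 <= pi :> R by have := @pi_ge2 R; lra.
have sq (x : R) : 0 < x -> x ^+ 2 = x `^ s * x `^ (2 - s).
  move=> x0; rewrite -powRD; last by rewrite (gt_eqF x0) implybT.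
  rewrite addrC subrK.
  by rewrite powR_mulrn// ltW.
have P (x y t : R) : 0 < x -> x <= y -> 0 <= t -> x `^ t <= y `^ t.
  move=> x0 xy t0; by apply: ge0_ler_powR => //; rewrite nnegrE; apply: ltW => //; exact: lt_le_trans xy.
have m0 : 0 <= Num.min 1 (pi * z / r).
  by rewrite le_min ler01 divr_ge0 ?(ltW r0)// mulr_ge0 ?pi_ge0// ltW.
have [rz|zr] := leP r z.
  apply: (@le_trans _ _ (r ^+ 2)).
    by rewrite exprMn ler_piMr ?sqr_ge0// expr_le1// ge_min lexx.
  rewrite -[leLHS]mul1r; apply: ler_pM => //; first exact: sqr_ge0.
    by rewrite expr2 mulr_ege1.
  by rewrite (sq r)// ler_wpM2l ?powR_ge0// P// subr_ge0 ltW.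
apply: (@le_trans _ _ ((pi * z) ^+ 2)).
  rewrite ler_pXn2r ?nnegrE//; last first.
  - by rewrite mulr_ge0 ?pi_ge0// ltW.
  - by rewrite mulr_ge0// ltW.
  apply: (@le_trans _ _ (r * (pi * z / r))).
    by rewrite ler_pM2l// ge_min lexx orbT.
  by rewrite mulrCA mulfV ?mulr1// gt_eqF.
rewrite exprMn ler_wpM2l ?sqr_ge0// sq// ler_wpM2r ?powR_ge0//.
by rewrite P// ltW.
Qed.

End Bump.

(** * Maxima of finitely many bumps *)

Section Hmax.
Context {R : realType} (I : finType) (r c1 c2 : I -> R).
Hypothesis r0 : forall i, 0 < r i.

Definition hmax (p1 p2 : R) : R := \big[Num.max/0]_i tbump (r i) (c1 i) (c2 i) p1 p2.

Lemma hmax_ge0 p1 p2 : 0 <= hmax p1 p2.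
Proof.
rewrite /hmax; elim/big_ind: _ => // [x y x0 _|i _]; first by rewrite le_max x0.
by have /andP[] := bump01 (r i) (c1 i) (c2 i) p1 p2.
Qed.

Lemma hmax_le1 p1 p2 : hmax p1 p2 <= 1.
Proof.
rewrite /hmax; elim/big_ind: _ => // [x y x0 y0|i _]; first by rewrite ge_max x0.
by have /andP[] := bump01 (r i) (c1 i) (c2 i) p1 p2.
Qed.

Lemma hmaxD1 p1 p2 : hmax (p1 + 1) p2 = hmax p1 p2.
Proof. by apply: eq_bigr => i _; rewrite bumpD1. Qed.

Lemma hmax1D p1 p2 : hmax p1 (p2 + 1) = hmax p1 p2.
Proof. by apply: eq_bigr => i _; rewrite bump_swap bumpD1 bump_swap. Qed.

Lemma hmax_ge (i : I) p1 p2 : tbump (r i) (c1 i) (c2 i) p1 p2 <= hmax p1 p2.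
Proof. by rewrite /hmax (bigD1 i)//= le_max lexx. Qed.

Lemma hmax_le_sum p1 p2 : hmax p1 p2 <= \sum_i tbump (r i) (c1 i) (c2 i) p1 p2.
Proof.
rewrite /hmax.
pose K (x y : R) := x <= y /\ 0 <= y.
suff [] : K (\big[Num.max/0]_i tbump (r i) (c1 i) (c2 i) p1 p2)
  (\sum_i tbump (r i) (c1 i) (c2 i) p1 p2) by [].
apply: (big_rec2 K); first by split.
move=> i x y _ [h y0]; have /andP[b0 _] := bump01 (r i) (c1 i) (c2 i) p1 p2.
by split; [rewrite ge_max lerDl y0 (le_trans h)// lerDr|rewrite addr_ge0].
Qed.

Lemma hmax_lip p1 p2 q1 q2 :
  `|hmax p1 p2 - hmax q1 q2| <= (\sum_i (r i)^-1) * tdist p1 p2 q1 q2.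
Proof.
rewrite /hmax mulr_suml.
pose K (x y z : R) := `|x - y| <= z /\ 0 <= z.
suff [] : K (\big[Num.max/0]_i tbump (r i) (c1 i) (c2 i) p1 p2)
  (\big[Num.max/0]_i tbump (r i) (c1 i) (c2 i) q1 q2)
  (\sum_i (r i)^-1 * tdist p1 p2 q1 q2) by [].
apply: (big_rec3 K); first by rewrite /K subrr normr0.
move=> i x y z _ [h z0]; have b := bump_lip (c1 i) (c2 i) p1 p2 q1 q2 (r0 i).
have b0 : 0 <= (r i)^-1 * tdist p1 p2 q1 q2 by rewrite mulr_ge0 ?invr_ge0 ?(ltW (r0 i))// addr_ge0.
split; last by rewrite addr_ge0.
rewrite mulrC in b; apply: (le_trans (ler_norm_max _ _ _ _)); rewrite ge_max.
by rewrite (le_trans b) ?lerDl//= (le_trans h)// lerDr.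
Qed.

(* The maximum does not increase the energy beyond the sum of those of the bumps:
   [(max a b - max a' b')^2 <= (a - a')^2 + (b - b')^2]. *)
Lemma hmax_shift_sqr z y1 y2 :
  shift1 z hmax y1 y2 ^+ 2 <= \sum_i shift1 z (tbump (r i) (c1 i) (c2 i)) y1 y2 ^+ 2.
Proof.
rewrite /shift1 /hmax.
pose K (x y z : R) := (x - y) ^+ 2 <= z.
apply: (big_rec3 K); first by rewrite /K subrr expr0n.
move=> i x y t _; rewrite /K; set a := tbump _ _ _ _ _; set b := tbump _ _ _ _ _ => h.
have M := ler_norm_max a b x y.
have [m|m] := leP `|x - y| `|a - b|.
  rewrite (max_l m) in M.
  apply: (@le_trans _ _ ((a - b) ^+ 2)); last by rewrite lerDl (le_trans _ h)// sqr_ge0.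
  by rewrite -real_normK ?num_real// -[leRHS]real_normK ?num_real// ler_pXn2r ?nnegrE.
rewrite (max_r (ltW m)) in M.
apply: (@le_trans _ _ ((x - y) ^+ 2)); last by rewrite (le_trans h)// lerDr sqr_ge0.
by rewrite -real_normK ?num_real// -[leRHS]real_normK ?num_real// ler_pXn2r ?nnegrE.
Qed.

End Hmax.

Lemma hmax_swap (R : realType) (I : finType) (r c1 c2 : I -> R) p1 p2 :
  hmax r c1 c2 p1 p2 = hmax r c2 c1 p2 p1.
Proof. by apply: eq_bigr => i _; rewrite bump_swap. Qed.

Section HmaxSum.
Context {R : realType} (I : finType) (r c1 c2 : I -> R).
Hypothesis r0 : forall i, 0 < r i.

(** For z = 2^-(j+2) the factor z^(2-s) is [si ^+ (2 * (j + 2))], at most [si ^+ (2 * j)]. The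
    energy is then at most 512 pi^2 e^2 [si ^+ (2 * j)], which gives the hypotheses of [main_sum]
    with amplitude 512 pi e. The condition on [4 * r i] says that the grid resolves every bump. *)
Lemma hmax_main_sum (s e C : R) (M : nat) (G : bool * nat -> bool * nat -> R) :
  let si := (2^-1) `^ ((2 - s) / 2) in
  0 <= s < 2 -> 0 < e <= 1 -> 0 <= C -> (forall i, r i <= 1) ->
  \sum_i r i `^ s <= e ^+ 2 ->
  (forall i, (4 * r i)^-1 <= (2 ^ M.+1)%:R) ->
  (forall a1 a2, `|G a1 a2| <= C / (1 + a1.2%:R + a2.2%:R)) ->
  `|\sum_(a1 : bool * 'I_(2 ^ M)) \sum_(a2 : bool * 'I_(2 ^ M))
    fejc (2 ^ M) a1.2 * fejc (2 ^ M) a2.2 * hhat (2 ^ M.+1) (hmax r c1 c2) (ix a1) (ix a2)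
    * G (ix a1) (ix a2)|
  <= 56 * C * (512 * pi * e) / (1 - si).
Proof.
move=> si s02 /andP[e0 e1] C0 r1 rs rM hG.
have N0 : (0 < 2 ^ M.+1)%N by rewrite expn_gt0.
have /andP[s0 s2] := s02.
have p1 : 1 <= pi :> R by have := @pi_ge2 R; lra.
have si0 : 0 < si by rewrite powR_gt0// invr_gt0.
have si1 : si < 1.
  have : 2^-1 `^ ((2 - s) / 2) < 1 `^ ((2 - s) / 2) :> R.
    by apply: gt0_ltr_powR; rewrite ?nnegrE//; lra.
  by rewrite powR1.
have [K KE] : exists K : R, K = 512 by exists 512.
have K1 : 256 <= K by rewrite KE ler_nat.
have K2 : 1 <= K by rewrite KE ler1n.
have K0 : 0 <= K by apply: le_trans K2.
rewrite -KE; have al0 : 0 < K * pi * e.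
  by apply: mulr_gt0 e0; apply: mulr_gt0; [exact: lt_le_trans K2|exact: pi_gt0].
have E j (f : R -> R -> R) (d1 d2 : I -> R) :
    (forall y1 y2, shift1 (2 ^- j.+2) f y1 y2 ^+ 2
       <= \sum_i shift1 (2 ^- j.+2) (tbump (r i) (d1 i) (d2 i)) y1 y2 ^+ 2) ->
    gmean2 (2 ^ M.+1) (fun y1 y2 => shift1 (2 ^- j.+2) f y1 y2 ^+ 2)
      <= (K * pi * e) ^+ 2 * si ^+ (2 * j).
  move=> hf; have z0 : 0 < 2 ^- j.+2 :> R by rewrite invr_gt0 exprn_gt0.
  apply: (le_trans (ler_gmean2 _ hf)); rewrite gmean2_sum.
  have zs : (2 ^- j.+2) `^ (2 - s) <= si ^+ (2 * j).
    have -> : 2 ^- j.+2 = 2^-1 `^ j.+2%:R :> R by rewrite powR_mulrn ?invr_ge0// exprVn.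
    rewrite -powRrM mulrC powRrM powR_mulrn ?powR_ge0//.
    have -> : 2^-1 `^ (2 - s) = si ^+ 2.
      by rewrite /si -powR_mulrn ?powR_ge0// -powRrM divfK.
    rewrite -exprM; apply: ler_wiXn2l; rewrite ?(ltW si0) ?(ltW si1)//.
    by rewrite leq_mul2l ltnW// ltnW.
  apply: (@le_trans _ _ (\sum_i K * (pi ^+ 2 * (r i `^ s * si ^+ (2 * j))))).
    apply: ler_sum => i _; apply: (le_trans (bump_energy _ _ N0 (r0 i) (ltW z0) (rM i))).
    rewrite -KE; apply: (ler_wpM2l K0); apply: (le_trans (scale_le s02 (r0 i) z0)).
    by apply: ler_wpM2l; [exact: sqr_ge0|apply: ler_wpM2l zs; exact: powR_ge0].
  have -> : \sum_i K * (pi ^+ 2 * (r i `^ s * si ^+ (2 * j)))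
     = K * (pi ^+ 2 * ((\sum_i r i `^ s) * si ^+ (2 * j))).
    by rewrite !mulr_suml !mulr_sumr.
  have q0 : 0 <= si ^+ (2 * j) by rewrite exprn_ge0// ltW.
  have := ler_wpM2r q0 rs => /(ler_wpM2l (_ : 0 <= pi ^+ 2)) - /(_ (sqr_ge0 _)) H.
  apply: (@le_trans _ _ (K * (pi ^+ 2 * (e ^+ 2 * si ^+ (2 * j))))); first exact: ler_wpM2l K0 _ _ H.
  have : 0 <= pi ^+ 2 * (e ^+ 2 * si ^+ (2 * j)) by rewrite mulr_ge0 ?sqr_ge0// mulr_ge0 ?sqr_ge0.
  set q := pi ^+ 2 * _ => qq0.
  have -> : (K * pi * e) ^+ 2 * si ^+ (2 * j) = K * K * q by rewrite /q; ring.
  by rewrite -mulrA ler_wpM2l// ler_peMl.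
apply: (@main_sum R M _ si C al0 si0 si1 C0) => //.
- exact: hmaxD1.
- exact: hmax1D.
- exact: hmax_ge0.
- apply: (le_trans (ler_gmean2 _ (hmax_le_sum _ _ _))); rewrite gmean2_sum.
  apply: (@le_trans _ _ (\sum_i 256 * r i `^ s)).
    apply: ler_sum => i _; apply: (le_trans (bump_mean _ _ N0 (r0 i) (rM i))).
    apply: ler_wpM2l; [by rewrite ler0n|]; rewrite -powR_mulrn ?(ltW (r0 i))//.
    by apply: ger_powR; rewrite ?r0 ?r1// ltW.
  rewrite -mulr_sumr; apply: (@le_trans _ _ (256 * e)).
    by apply: ler_wpM2l; [rewrite ler0n|apply: (le_trans rs); rewrite expr2 ler_piMr// ltW].
  apply: (ler_wpM2r (ltW e0)); apply: (le_trans K1).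
  by rewrite ler_peMr.
- by move=> j _; apply: E => y1 y2; exact: hmax_shift_sqr.
- move=> j _; apply: (E j _ c2 c1) => y1 y2.
  have := @hmax_shift_sqr _ _ r c2 c1 (2 ^- j.+2) y1 y2; apply: le_trans.
  by rewrite /shift1 !(hmax_swap r c2 c1).
Qed.

End HmaxSum.

(** * Integration against a signed measure *)

Section Functional.
Context {d : measure_display} {X : measurableType d} {R : realType}.
Implicit Types f g : X -> R.

Definition bmf f := measurable_fun setT f /\ exists B : R, forall x, `|f x| <= B.

Lemma bmf_cst (k : R) : bmf (fun=> k).
Proof. by split; [exact: measurable_cst|exists `|k|]. Qed.

Lemma bmfD f g : bmf f -> bmf g -> bmf (fun x => f x + g x).
Proof.
move=> [mf [A hA]] [mg [B hB]]; split; first exact: measurable_funD.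
by exists (A + B) => x; rewrite (le_trans (ler_normD _ _))// lerD.
Qed.

Lemma bmfM f g : bmf f -> bmf g -> bmf (fun x => f x * g x).
Proof.
move=> [mf [A hA]] [mg [B hB]]; split; first exact: measurable_funM.
by exists (A * B) => x; rewrite normrM ler_pM.
Qed.

Lemma bmfZ (k : R) f : bmf f -> bmf (fun x => k * f x).
Proof. exact: bmfM (bmf_cst k). Qed.

Lemma bmf_sum (I : Type) (s : seq I) (F : I -> X -> R) :
  (forall i, bmf (F i)) -> bmf (fun x => \sum_(i <- s) F i x).
Proof.
move=> bF; elim: s => [|i s IH].
  by under eq_fun do rewrite big_nil; exact: bmf_cst.
by under eq_fun do rewrite big_cons; exact: bmfD.
Qed.

Lemma bmf_cos f : measurable_fun setT f -> bmf (fun x => cos (f x)).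
Proof.
move=> mf; split; last by exists 1 => x; exact: cos_max.
by apply: (measurableT_comp _ mf); apply: continuous_measurable_fun; exact: continuous_cos.
Qed.

Lemma bmf_sin f : measurable_fun setT f -> bmf (fun x => sin (f x)).
Proof.
move=> mf; split; last by exists 1 => x; exact: sin_max.
by apply: (measurableT_comp _ mf); apply: continuous_measurable_fun; exact: continuous_sin.
Qed.

Lemma bmf_tg a f : measurable_fun setT f -> bmf (fun x => tg a (f x)).
Proof.
move=> mf; have m : measurable_fun setT (fun x => 2 * pi * a.2%:R * f x).
  by apply: measurable_funM => //; exact: measurable_cst.
by rewrite /tg; case: a.1; [exact: bmf_sin|exact: bmf_cos].
Qed.

Lemma bmf_cvg (F : nat -> X -> R) f (B : R) : (forall n, bmf (F n)) ->
  (forall n x, `|F n x| <= B) -> (forall x, F ^~ x @ \oo --> f x) -> bmf f.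
Proof.
move=> bF hB hF; split.
  by apply: (@measurable_fun_cvg _ _ _ _ F) => [n|x _]; [have [] := bF n|exact: hF].
exists B => x; rewrite -(cvg_lim _ (cvg_norm (hF x)))//.
apply: limr_le; first by apply: cvgP; exact: cvg_norm (hF x).
by apply: nearW => n.
Qed.

Context {T : finType} (nu : T -> {finite_measure set X -> \bar R}) (c : T -> R).

(* Integration against the real signed measure [\sum_t c t * nu t]. *)
Definition Lam f : R := \sum_t c t * (\int[nu t]_x f x)%R.

Lemma bmf_integrable f t : bmf f -> (nu t).-integrable setT (EFin \o f).
Proof.
move=> [mf [B hB]]; apply: measurable_bounded_integrable => //.
  by rewrite ltey_eq fin_num_measure.
by exists B; split; [exact: num_real|move=> M BM x _; exact: le_trans (ltW BM)].
Qed.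

Lemma eq_Lam f g : f =1 g -> Lam f = Lam g.
Proof. by move=> fg; rewrite (_ : f = g)//; apply/funext. Qed.

Lemma LamD f g : bmf f -> bmf g -> Lam (fun x => f x + g x) = Lam f + Lam g.
Proof.
move=> bf bg; rewrite /Lam -big_split; apply: eq_bigr => t _.
by rewrite RintegralD ?mulrDr//; exact: bmf_integrable.
Qed.

Lemma LamZ k f : bmf f -> Lam (fun x => k * f x) = k * Lam f.
Proof.
move=> bf; rewrite /Lam mulr_sumr; apply: eq_bigr => t _.
rewrite RintegralZl//; first by rewrite mulrCA.
exact: bmf_integrable.
Qed.

Lemma Lam_sum (I : Type) (s : seq I) (F : I -> X -> R) : (forall i, bmf (F i)) ->
  Lam (fun x => \sum_(i <- s) F i x) = \sum_(i <- s) Lam (F i).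
Proof.
move=> bF; elim: s => [|i s IH].
  rewrite big_nil (@eq_Lam _ (fun x => 0 * 1)); first by rewrite LamZ ?mul0r//; exact: bmf_cst.
  by move=> x; rewrite big_nil mul0r.
rewrite big_cons -IH -LamD//; first by apply: eq_Lam => x; rewrite big_cons.
exact: bmf_sum.
Qed.

Lemma Lam_cvg (F : nat -> X -> R) f (B : R) : (forall n, bmf (F n)) ->
  (forall n x, `|F n x| <= B) -> (forall x, F ^~ x @ \oo --> f x) ->
  (fun n => Lam (F n)) @ \oo --> Lam f.
Proof.
move=> bF hB hF; have bf := bmf_cvg bF hB hF.
rewrite /Lam; elim: (index_enum T) => [|t s IH].
  by under eq_fun do rewrite big_nil; rewrite big_nil; exact: cvg_cst.
under eq_fun do rewrite big_cons; rewrite big_cons; apply: cvgD IH.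
apply: cvgMl_tmp.
have [|||||_ _] := @dominated_convergence _ _ _ (nu t) setT measurableT (fun n => EFin \o F n)
  (EFin \o f) (EFin \o (fun=> B)).
- by move=> n; apply/measurable_EFinP; exact: (bF n).1.
- by apply/measurable_EFinP; exact: bf.1.
- by apply: aeW => x _; apply: cvg_EFin; [exact: nearW|exact: hF].
- exact: (bmf_integrable t (bmf_cst B)).
- by apply: aeW => x n _; rewrite /= lee_fin.
rewrite -(fineK (integrable_fin_num _ (bmf_integrable t bf)))//.
by move/fine_cvg.
Qed.

(** The push-forward to the torus is never formed: composition of trigonometric polynomials with
    [u1] and [u2] plays its part. *)
Lemma samp_lin (L N : nat) (h : R -> R -> R) (u1 u2 g : X -> R) : (0 < L)%N ->
  measurable_fun setT u1 -> measurable_fun setT u2 -> bmf g ->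
  bmf (fun x => samp L N h (u1 x) (u2 x)) /\
  Lam (fun x => samp L N h (u1 x) (u2 x) * g x) =
  \sum_(a1 : bool * 'I_L) \sum_(a2 : bool * 'I_L)
    fejc L a1.2 * fejc L a2.2 * hhat N h (ix a1) (ix a2) *
     Lam (fun x => tg (ix a1) (u1 x) * tg (ix a2) (u2 x) * g x).
Proof.
move=> L0 m1 m2 bg.
have b1 a1 a2 : bmf (fun x => tg a1 (u1 x) * tg a2 (u2 x)).
  by apply: bmfM; exact: bmf_tg.
split.
  under eq_fun do rewrite samp_expand; apply: bmf_sum => a1; apply: bmf_sum => a2.
  exact: bmfZ.
rewrite (@eq_Lam _ (fun x => \sum_(a1 : bool * 'I_L) \sum_(a2 : bool * 'I_L)
    fejc L a1.2 * fejc L a2.2 * hhat N h (ix a1) (ix a2)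
    * (tg (ix a1) (u1 x) * tg (ix a2) (u2 x) * g x))).
  rewrite Lam_sum => [|a1]; last by apply: bmf_sum => a2; apply: bmfZ; exact: bmfM.
  apply: eq_bigr => a1 _; rewrite Lam_sum => [|a2]; last by apply: bmfZ; exact: bmfM.
  by apply: eq_bigr => a2 _; rewrite LamZ//; exact: bmfM.
move=> x; rewrite samp_expand mulr_suml; apply: eq_bigr => a1 _.
by rewrite mulr_suml; apply: eq_bigr => a2 _; rewrite !mulrA.
Qed.

End Functional.

(** * Integrals of maxima of bumps under Fourier decay *)

Definition sigma_exp {R : realType} (s : R) : R := 2^-1 `^ ((2 - s) / 2).

Section Decay.
Context {d : measure_display} {X : measurableType d} {R : realType}.
Context {T : finType} (nu : T -> {finite_measure set X -> \bar R}) (c : T -> R).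
Context (u1 u2 : X -> R).
Hypotheses (mu1 : measurable_fun setT u1) (mu2 : measurable_fun setT u2).

Definition decay (C : R) (g : X -> R) := forall a1 a2,
  `|Lam nu c (fun x => tg a1 (u1 x) * tg a2 (u2 x) * g x)| <= C / (1 + a1.2%:R + a2.2%:R).

Lemma samp_cvg (h : R -> R -> R) (K : R) p1 p2 : 0 <= K ->
  (forall q1 q2, `|h q1 q2 - h p1 p2| <= K * tdist p1 p2 q1 q2) ->
  (fun M => samp (2 ^ M.+1) (2 ^ M.+2) h p1 p2) @ \oo --> h p1 p2.
Proof.
move=> K0 hK; apply/cvgrPdist_le => /= e e0.
pose e' := e / (2 * (K + 1)).
have K10 : 0 < K + 1 by rewrite ltr_wpDl.
have e'0 : 0 < e' by rewrite divr_gt0// mulr_gt0.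
have e'E : K * (e' + e') <= e.
  apply: (@le_trans _ _ ((K + 1) * (e' + e'))).
    by rewrite ler_pM2r ?addr_gt0// lerDl.
  by rewrite /e' le_eqVlt; apply/orP; left; apply/eqP; field; rewrite gt_eqF.
clearbody e'; near=> M.
rewrite distrC; apply: (le_trans (samp_close _ _ K0 e'0 hK)).
- by rewrite (@leq_exp2l 2 1).
- by rewrite ltn_exp2l.
have MM : (2 * e' ^+ 2)^-1 <= (2 ^ M.+1)%:R.
  apply: (@le_trans _ _ M%:R); first by near: M; exact: nbhs_infty_ger.
  by rewrite ler_nat ltnW// (ltn_trans (ltnSn _))// ltn_expl.
have e2 : (2 * (2 ^ M.+1)%:R * e')^-1 <= e'.
  have L0 : 0 < (2 ^ M.+1)%:R :> R by rewrite ltr0n expn_gt0.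
  rewrite -[leLHS]mul1r ler_pdivrMr; last by rewrite mulr_gt0// mulr_gt0.
  move: MM; rewrite -[leLHS]mul1r ler_pdivrMr; last by rewrite mulr_gt0// exprn_gt0.
  by move/le_trans; apply; rewrite le_eqVlt; apply/orP; left; apply/eqP; ring.
apply: le_trans e'E; first by rewrite ler_wpM2l// lerD2l.
Unshelve. all: by end_near. Qed.

(** The bound holds for the Fejer means of [hmax] uniformly in their degree. They stay bounded by 1
    and converge pointwise since [hmax] is Lipschitz, so dominated convergence carries the bound
    over. *)
Lemma Lam_hmax_le (I : finType) (r c1 c2 : I -> R) (s e C : R) (g : X -> R) :
  (forall i, 0 < r i <= 1) -> 0 <= s < 2 -> 0 < e <= 1 -> 0 <= C ->
  \sum_i r i `^ s <= e ^+ 2 -> bmf g -> decay C g ->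
  bmf (fun x => hmax r c1 c2 (u1 x) (u2 x)) /\
  `|Lam nu c (fun x => hmax r c1 c2 (u1 x) (u2 x) * g x)| <= 56 * C * (512 * pi * e) / (1 - sigma_exp s).
Proof.
move=> r01 s02 e01 C0 rs bg hg.
have r0 i : 0 < r i by have /andP[] := r01 i.
have r1 i : r i <= 1 by have /andP[] := r01 i.
pose F M x := samp (2 ^ M.+1) (2 ^ M.+2) (hmax r c1 c2) (u1 x) (u2 x).
have K0 : 0 <= \sum_i (r i)^-1 by apply: sumr_ge0 => i _; rewrite invr_ge0 ltW.
have Fc x : F ^~ x @ \oo --> hmax r c1 c2 (u1 x) (u2 x).
  apply: (samp_cvg K0) => q1 q2; rewrite tdistC; exact: hmax_lip.
have L0 M : (0 < 2 ^ M)%N by rewrite expn_gt0.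
have bF M : bmf (F M) := (samp_lin nu c (2 ^ M.+2)%N (hmax r c1 c2) (L0 M.+1) mu1 mu2 bg).1.
have F1 M x : `|F M x| <= 1.
  apply: samp_le1 => [||y1 y2]; rewrite ?hmax_ge0 ?hmax_le1//.
  - by rewrite (@leq_exp2l 2 1).
  - by rewrite ltn_exp2l.
split; first exact: (bmf_cvg bF F1 Fc).
have [_ [B hB]] := bg.
have B0 x : 0 <= B := le_trans (normr_ge0 _) (hB x).
have cv : (fun M => Lam nu c (fun x => F M x * g x)) @ \oo -->
    Lam nu c (fun x => hmax r c1 c2 (u1 x) (u2 x) * g x).
  apply: (@Lam_cvg _ _ _ _ _ _ _ _ B) => [M|M x|x]; first exact: bmfM.
    by rewrite normrM -[leRHS]mul1r ler_pM.
  by apply: cvgMr_tmp; exact: Fc.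
rewrite -(cvg_lim _ (cvg_norm cv))//; apply: limr_le.
  by apply: cvgP; exact: cvg_norm cv.
near=> M.
rewrite (samp_lin nu c _ _ (L0 M.+1) mu1 mu2 bg).2.
apply: (@hmax_main_sum _ _ _ _ _ r0 s e C M.+1
    (fun a1 a2 => Lam nu c (fun x => tg a1 (u1 x) * tg a2 (u2 x) * g x))) => // i.
(* The sum dominates every [(4 * r i)^-1], so a single condition on [M] serves all [i]. *)
apply: (@le_trans _ _ (\sum_i (4 * r i)^-1)).
  by rewrite (bigD1 i)//= lerDl sumr_ge0// => j _; rewrite invr_ge0 mulr_ge0// ltW.
apply: (@le_trans _ _ M%:R); first by near: M; exact: nbhs_infty_ger.
by rewrite ler_nat ltnW// (ltn_trans _ (ltn_expl _ _))//; lia.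
Unshelve. all: by end_near. Qed.

End Decay.

Lemma hmax_le_bound {R : realType} (I : finType) (r c1 c2 : I -> R) (p1 p2 y : R) :
  0 <= y -> (forall i, tbump (r i) (c1 i) (c2 i) p1 p2 <= y) -> hmax r c1 c2 p1 p2 <= y.
Proof.
by move=> y0 h; rewrite /hmax; elim/big_ind: _ => // a b ha hb; rewrite ge_max ha.
Qed.

(** The k-th covering will have sum at most 4^-k / 2; together, those from rank [K] on then meet the
    condition of [Lam_hmax_le] with [e = 2^-1 ^+ K]. *)
Lemma sum_quarter {R : realType} (K M : nat) :
  \sum_(k < M) 2^-1 * 4^-1 ^+ (K + k) <= (2^-1 ^+ K) ^+ 2 :> R.
Proof.
have E : (2^-1 ^+ K) ^+ 2 = 4^-1 ^+ K :> R.
  by rewrite exprAC expr2 -invfM -natrM.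
rewrite E; under eq_bigr do rewrite exprD mulrCA.
rewrite -mulr_sumr -mulr_sumr ler_piMr ?exprn_ge0 ?invr_ge0//.
have := @geometric_le R (4^-1) _ _ M; have : 0 < 4^-1 :> R by rewrite invr_gt0.
have h4 : 4^-1 < 1 :> R by rewrite invf_lt1// ltr1n.
move=> h0 /(_ h0 h4); set S := \sum_(_ < _) _.
have -> : (1 - 4^-1)^-1 = 4 / 3 :> R by field.
lra.
Qed.

(** * The limsup of the bumps over a sequence of coverings *)

Section LimsupBump.
Context {d : measure_display} {X : measurableType d} {R : realType}.
Context (u1 u2 : X -> R) (r c1 c2 : nat -> nat -> R) (s : R).
Hypotheses (mu1 : measurable_fun setT u1) (mu2 : measurable_fun setT u2).
Hypotheses (r01 : forall k i, 0 < r k i <= 1) (s02 : 0 <= s < 2).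
Hypothesis rs : forall k n, \sum_(i < n) r k i `^ s <= 2^-1 * 4^-1 ^+ k.

(** A finite truncation, to which the estimates for [hmax] apply. It increases with [M], and its
    supremum decreases with [K], so the limsup is reached by two monotone pointwise limits. *)
Let F (K M : nat) (x : X) : R :=
  hmax (fun ki : 'I_M * 'I_M => r (K + ki.1)%N ki.2) (fun ki => c1 (K + ki.1)%N ki.2)
    (fun ki => c2 (K + ki.1)%N ki.2) (u1 x) (u2 x).

Let F_le1 K M (x : X) : F K M x <= 1. Proof. exact: hmax_le1. Qed.

Let F_ge0 K M (x : X) : 0 <= F K M x. Proof. exact: hmax_ge0. Qed.

Let F_ge K M (x : X) (k i : nat) : (k < M)%N -> (i < M)%N ->
  tbump (r (K + k) i) (c1 (K + k) i) (c2 (K + k) i) (u1 x) (u2 x) <= F K M x.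
Proof.
move=> kM iM; exact: (@hmax_ge _ _ _ _ _ (Ordinal kM, Ordinal iM)).
Qed.

Let F_le K M (x : X) (y : R) : 0 <= y -> (forall k i, (k < M)%N -> (i < M)%N ->
   tbump (r (K + k) i) (c1 (K + k) i) (c2 (K + k) i) (u1 x) (u2 x) <= y) -> F K M x <= y.
Proof. by move=> y0 h; apply: hmax_le_bound => // -[k i]; exact: h. Qed.

Let F_mono K (x : X) : {homo F K ^~ x : M M' / (M <= M')%N >-> M <= M'}.
Proof.
by move=> M M' MM; apply: F_le => // k i kM iM; apply: F_ge; exact: leq_trans MM.
Qed.

Let f (K : nat) (x : X) : R := sup (range (F K ^~ x)).

Let f_cvg K (x : X) : F K ^~ x @ \oo --> f K x.
Proof. by apply: nondecreasing_cvgn; [exact: F_mono|exists 1 => _ [M _ <-]; exact: F_le1]. Qed.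

Let f_ge K M (x : X) : F K M x <= f K x.
Proof.
by apply: ub_le_sup; [exists 1 => _ [N _ <-]; exact: F_le1|exists M].
Qed.

Let f_le K (x : X) (y : R) : (forall M, F K M x <= y) -> f K x <= y.
Proof. by move=> h; apply: ge_sup; [exists (F K 0%N x); exists 0%N|move=> _ [M _ <-]]. Qed.

Let f_mono (x : X) : {homo f ^~ x : K K' / (K <= K')%N >-> K' <= K}.
Proof.
move=> K K' KK; apply: f_le => M; apply: F_le => [|k i kM iM].
  by rewrite (le_trans _ (f_ge K 0 x)).
rewrite (_ : (K' + k = K + (K' - K + k))%N); last by lia.
apply: le_trans (f_ge K (K' - K + M) x); apply: F_ge; lia.
Qed.

Let f0 (x : X) : R := inf (range (f ^~ x)).

Let f0_cvg (x : X) : f ^~ x @ \oo --> f0 x.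
Proof.
apply: nonincreasing_cvgn; first exact: f_mono.
by exists 0 => _ [K _ <-]; rewrite (le_trans _ (f_ge K 0 x)).
Qed.

(** The order of the quantifiers matters: one [f0] has to serve every twist [g] and every
    functional. The integrals of the truncations are O(2^-K) uniformly in [M], hence zero after both
    limits. *)
Lemma limsup_bump : exists f0 : X -> R,
  [/\ bmf f0,
      (forall x, (forall k, exists i, tdist (u1 x) (u2 x) (c1 k i) (c2 k i) <= r k i) -> f0 x = 1) &
      forall (T : finType) (nu : T -> {finite_measure set X -> \bar R}) (c : T -> R)
        (g : X -> R) (C : R),
        0 <= C -> bmf g -> decay nu c u1 u2 C g -> Lam nu c (fun x => f0 x * g x) = 0].
Proof.
have rI K M : \sum_(ki : 'I_M * 'I_M) r (K + ki.1)%N ki.2 `^ s <= (2^-1 ^+ K) ^+ 2.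
  rewrite -(pair_big xpredT xpredT (fun k i : 'I_M => r (K + k)%N i `^ s))/=.
  by apply: le_trans (sum_quarter K M); apply: ler_sum => k _; exact: rs.
have e01 K : 0 < (2^-1 : R) ^+ K <= 1.
  by rewrite exprn_gt0 ?invr_gt0//= exprn_ile1 ?invr_ge0// invf_le1// ler1n.
have bF K M : bmf (F K M).
  (* An empty family of measures suffices here, as only the measurability half of [Lam_hmax_le] is
     wanted. *)
  have h0 : decay (fun=> mzero : {finite_measure set X -> \bar R}) (fun t : void => 0 : R)
    u1 u2 0 (fun=> 0).
    by move=> a1 a2; rewrite /Lam big1 ?normr0 ?mul0r// => -[].
  have := @Lam_hmax_le _ _ _ _ _ _ u1 u2 mu1 mu2 _ (fun ki : 'I_M * 'I_M => r (K + ki.1)%N ki.2)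
    (fun ki => c1 (K + ki.1)%N ki.2) (fun ki => c2 (K + ki.1)%N ki.2) s
    (2^-1 ^+ K) 0 (fun=> 0) (fun ki => r01 _ _) s02 (e01 K)
    (lexx 0) (rI K M) (bmf_cst 0) h0.
  by case.
have F1 K M x : `|F K M x| <= 1 by rewrite ger0_norm.
have bf K : bmf (f K) by apply: (bmf_cvg (bF K) (F1 K)) => x; exact: f_cvg.
have f1 K x : `|f K x| <= 1.
  by rewrite ger0_norm ?f_le// (le_trans _ (f_ge K 0 x)).
exists f0; split; first by apply: (bmf_cvg bf f1) => x; exact: f0_cvg.
  move=> x hx; suff fK K : f K x = 1.
    apply: (@cvg_unique _ _ (f ^~ x @ \oo)); [exact: norm_hausdorff|exact: f0_cvg|].
    by apply: cvg_near_cst; exact: nearW.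
  apply/eqP; rewrite eq_le f_le//=; have [i hi] := hx K.
  apply: le_trans (f_ge K i.+1 x).
  have := @F_ge K i.+1 x 0 i isT (ltnSn i); rewrite addn0 bump_eq1//.
  by have /andP[] := r01 K i.
move=> T nu c g C C0 bg hg; have [_ [B hB]] := bg.
have BB (h : X -> R) x : `|h x| <= 1 -> `|h x * g x| <= B.
  by move=> hx; rewrite normrM -[leRHS]mul1r ler_pM.
pose A := 56 * C * (512 * pi) / (1 - sigma_exp s).
have LF K M : `|Lam nu c (fun x => F K M x * g x)| <= A * 2^-1 ^+ K.
  have [_] := @Lam_hmax_le _ _ _ _ nu c u1 u2 mu1 mu2 _ (fun ki : 'I_M * 'I_M => r (K + ki.1)%N ki.2)
    (fun ki => c1 (K + ki.1)%N ki.2) (fun ki => c2 (K + ki.1)%N ki.2) s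
    (2^-1 ^+ K) C g (fun ki => r01 _ _) s02 (e01 K)
    C0 (rI K M) bg hg.
  by move/le_trans; apply; rewrite /A !mulrA mulrAC.
have Lf K : `|Lam nu c (fun x => f K x * g x)| <= A * 2^-1 ^+ K.
  have cv : (fun M => Lam nu c (fun x => F K M x * g x)) @ \oo --> Lam nu c (fun x => f K x * g x).
    apply: (@Lam_cvg _ _ _ _ _ _ _ _ B) => [M|M x|x]; [exact: bmfM|exact: BB|].
    by apply: cvgMr_tmp; exact: f_cvg.
  rewrite -(cvg_lim _ (cvg_norm cv))//; apply: limr_le; last exact: nearW.
  by apply: cvgP; exact: cvg_norm cv.
have cv : (fun K => Lam nu c (fun x => f K x * g x)) @ \oo --> Lam nu c (fun x => f0 x * g x).
  apply: (@Lam_cvg _ _ _ _ _ _ _ _ B) => [M|M x|x]; [exact: bmfM|exact: BB|].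
  by apply: cvgMr_tmp; exact: f0_cvg.
apply: (@cvg_unique _ _ ((fun K => Lam nu c (fun x => f K x * g x)) @ \oo)) => //.
apply/norm_cvg0P.
apply: (@squeeze_cvgr _ _ _ _ (fun=> 0) (fun K => A * 2^-1 ^+ K)).
- by apply: nearW => K; rewrite normr_ge0 Lf.
- exact: cvg_cst.
- rewrite -(mulr0 A); apply: cvgMl_tmp; apply: cvg_expr.
  by rewrite ger0_norm ?invr_ge0// invf_lt1// ltr1n.
Qed.

End LimsupBump.

(** * Fourier uniqueness *)

Lemma bernoulli_ineq {R : realType} (x : R) (n : nat) : -1 <= x -> 1 + n%:R * x <= (1 + x) ^+ n.
Proof.
move=> x1; elim: n => [|n IH]; first by rewrite mul0r addr0.
rewrite exprS; apply: (@le_trans _ _ ((1 + x) * (1 + n%:R * x))).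
  have -> : (1 + x) * (1 + n%:R * x) = 1 + n.+1%:R * x + n%:R * x ^+ 2.
    by rewrite -[n.+1%:R]natr1; ring.
  by rewrite lerDl mulr_ge0// sqr_ge0.
by apply: ler_wpM2l IH; lra.
Qed.

(** With q = p^2, one factor p^n absorbs n: Bernoulli's inequality for p^-1 = 1 + D gives n p^n <= 1
    / D. *)
Lemma natmul_expr_cvg0 {R : realType} (q : R) : 0 <= q < 1 ->
  (fun n => n%:R * q ^+ n) @ \oo --> (0 : R).
Proof.
move=> /andP[q0 q1].
have [->|qN0] := eqVneq q 0.
  apply: cvg_near_cst; near=> n; rewrite expr0n; case: eqP => [->|_]; by rewrite ?mul0r ?mulr0.
have qp : 0 < q by rewrite lt_neqAle eq_sym qN0.
pose p := Num.sqrt q; have pp : 0 < p by rewrite sqrtr_gt0.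
have pq : q = p ^+ 2 by rewrite sqr_sqrtr.
have p1 : p < 1 by rewrite -(expr_lt1 (n:=2))// ?(ltW pp)// -pq.
pose D := p^-1 - 1.
have D0 : 0 < D by rewrite subr_gt0 invf_gt1.
apply: (@squeeze_cvgr _ _ _ _ (fun=> 0) (fun n => D^-1 * p ^+ n)).
- apply: nearW => n; rewrite mulr_ge0 ?exprn_ge0//=.
  have b := @bernoulli_ineq R D n.
  have {b} b : n%:R * D <= p ^- n.
    rewrite -exprVn; have -> : p^-1 = 1 + D by rewrite /D addrC subrK.
    apply: le_trans (b _); first by rewrite lerDr.
    by rewrite (le_trans _ (ltW D0))// lerN10.
  rewrite pq -exprM mulnC exprM exprnP -[leLHS]/(n%:R * (p ^+ n) ^+ 2).
  have pn : 0 < p ^+ n by rewrite exprn_gt0.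
  rewrite expr2 mulrA ler_pM2r// -(ler_pM2r D0) mulVf ?gt_eqF//.
  by rewrite mulrAC -ler_pdivlMr// mul1r.
- exact: cvg_cst.
- rewrite -(mulr0 D^-1); apply: cvgMl_tmp; apply: cvg_expr.
  by rewrite ger0_norm// ltW.
Unshelve. all: by end_near. Qed.

(* The polynomials of Brosowski and Deutsch's proof of the Stone-Weierstrass theorem. *)
Lemma step_poly_cvg {R : realType} (t : R) : 0 <= t <= 1 ->
  (fun n => (1 - t ^+ n) ^+ (n * 2 ^ n)) @ \oo --> (((t < 2^-1)%R : nat)%:R : R).
Proof.
move=> /andP[t0 t1].
have tn n : 0 <= t ^+ n <= 1 by rewrite exprn_ge0// exprn_ile1.
have pr n : 0 <= (1 - t ^+ n) ^+ (n * 2 ^ n) <= 1.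
  have /andP[a b] := tn n.
  by rewrite exprn_ge0 ?subr_ge0//= exprn_ile1 ?subr_ge0// gerBl.
have [tl|tl] := ltP t 2^-1 => /=.
  apply: (@squeeze_cvgr _ _ _ _ (fun n => 1 - n%:R * (2 * t) ^+ n) (fun=> 1)).
  - apply: nearW => n; have /andP[_ ->] := pr n; rewrite andbT.
    have /andP[a b] := tn n.
    apply: le_trans (bernoulli_ineq _ _); last by rewrite lerN2.
    by rewrite mulrN natrM natrX exprMn mulrA.
  - rewrite -[X in _ --> X]subr0; apply: cvgB; first exact: cvg_cst.
    apply: natmul_expr_cvg0; rewrite mulr_ge0//=; lra.
  - exact: cvg_cst.
have tp : 0 < t by apply: lt_le_trans tl; rewrite invr_gt0.
apply: (@squeeze_cvgr _ _ _ _ (fun=> 0) (fun n => n.+1%:R^-1)).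
- apply: nearW => n; have /andP[-> _] := pr n; rewrite /=.
  have /andP[a b] := tn n.
  (* Since (1 - x)(1 + x) <= 1, the lower bound n + 1 for the power of 1 + t^n becomes an upper
     bound for the power of 1 - t^n. *)
  have c : (1 - t ^+ n) ^+ (n * 2 ^ n) * (1 + t ^+ n) ^+ (n * 2 ^ n) <= 1.
    have /andP[q0 q1] : 0 <= (1 - t ^+ n) * (1 + t ^+ n) <= 1 by apply/andP; split; nra.
    by rewrite -exprMn exprn_ile1.
  have e : n.+1%:R <= (1 + t ^+ n) ^+ (n * 2 ^ n).
    apply: le_trans (bernoulli_ineq _ _); last by apply: le_trans a; rewrite lerN10.
    rewrite -natr1 addrC lerD2l natrM natrX -mulrA -exprMn ler_peMr//.
    by apply: exprn_ege1; lra.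
  rewrite -[leRHS]mul1r ler_pdivlMr ?ltr0n//; apply: le_trans c.
  by rewrite ler_wpM2l//; have /andP[] := pr n.
- exact: cvg_cst.
- exact: cvg_harmonic.
Qed.

Section Uniqueness.
Context {R : realType} (n : nat) {T : finType}
  (nu : T -> {finite_measure set (@Rn R n) -> \bar R}) (c : T -> R).
Implicit Types (f g m : @Rn R n -> R) (eta zeta : 'rV[R]_n).

Lemma measurable_coord (i : 'I_n) : measurable_fun setT (fun x : @Rn R n => x ord0 i : R).
Proof.
apply: (measurability (@RGenOpens.G R)); first exact: RGenOpens.measurableE.
move=> _ [_ [a [b ->]] <-]; rewrite setTI; apply: sub_sigma_algebra.
apply: open_comp; last exact: itv_open.
by move=> x _; exact: coord_continuous.
Qed.

Lemma measurable_dotR eta : measurable_fun setT (fun x : @Rn R n => dotR eta x).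
Proof.
apply: measurable_sum => i; apply: measurable_funM; first exact: measurable_cst.
exact: measurable_coord.
Qed.

Definition cs (b : bool) eta (x : @Rn R n) : R := if b then sin (dotR eta x) else cos (dotR eta x).

Lemma bmf_cs b eta : bmf (cs b eta).
Proof.
by case: b; [apply: bmf_sin|apply: bmf_cos]; exact: measurable_dotR.
Qed.

Lemma dotRD eta zeta x : dotR (eta + zeta) x = dotR eta x + dotR zeta x.
Proof. by rewrite /dotR -big_split; apply: eq_bigr => i _; rewrite mxE mulrDl. Qed.

Lemma dotRB eta zeta x : dotR (eta - zeta) x = dotR eta x - dotR zeta x.
Proof. by rewrite /dotR -sumrB; apply: eq_bigr => i _; rewrite !mxE mulrBl. Qed.

Lemma csM b b' eta zeta x : cs b eta x * cs b' zeta x =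
  2^-1 * ((if b && b' then -1 else 1) * cs (b (+) b') (eta + zeta) x
    + (if ~~ b && b' then -1 else 1) * cs (b (+) b') (eta - zeta) x).
Proof.
rewrite /cs dotRD dotRB; case: b b' => -[] /=; rewrite ?sinB ?cosB ?sinD ?cosD; by field.
Qed.

Context (f0 : @Rn R n -> R).
Hypothesis bf0 : bmf f0.
Hypothesis f00 : forall b eta, Lam nu c (fun x => f0 x * cs b eta x) = 0.

(* The multipliers form an algebra, closed under bounded pointwise limits, which
   contains the trigonometric functions; so it contains all indicators of Borel sets. *)
Definition annihilated g := bmf g /\
  forall b eta, Lam nu c (fun x => f0 x * (g x * cs b eta x)) = 0.

(** Asking [m] to preserve all annihilated functions, instead of being one, makes closure under
    products immediate. *)
Definition multiplier m := bmf m /\ forall g, annihilated g -> annihilated (fun x => m x * g x).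

Lemma annihilated1 : annihilated (fun=> 1).
Proof.
split; first exact: bmf_cst.
by move=> b eta; rewrite -[RHS](f00 b eta); apply: eq_Lam => x; rewrite mul1r.
Qed.

Let bmf3 g b eta : bmf g -> bmf (fun x => f0 x * (g x * cs b eta x)).
Proof. by move=> bg; apply: bmfM bf0 _; apply: bmfM bg _; exact: bmf_cs. Qed.

Lemma annihilatedD g g' : annihilated g -> annihilated g' -> annihilated (fun x => g x + g' x).
Proof.
move=> [bg hg] [bg' hg']; split; first exact: bmfD.
move=> b eta; rewrite -[RHS]addr0 -{1}(hg b eta) -(hg' b eta) -LamD; [|exact: bmf3..].
by apply: eq_Lam => x; ring.
Qed.

Lemma annihilatedZ k g : annihilated g -> annihilated (fun x => k * g x).
Proof.
move=> [bg hg]; split; first exact: bmfZ.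
move=> b eta; rewrite -[RHS](mulr0 k) -(hg b eta) -LamZ; last exact: bmf3.
by apply: eq_Lam => x; ring.
Qed.

Lemma annihilated_cvg (G : nat -> @Rn R n -> R) g (B : R) : (forall k, annihilated (G k)) ->
  (forall k x, `|G k x| <= B) -> (forall x, G ^~ x @ \oo --> g x) -> annihilated g.
Proof.
move=> hG hB cG; split; first by apply: (bmf_cvg _ hB cG) => k; have [] := hG k.
move=> b eta; have [_ [A hA]] := bmf3 b eta (bmf_cst 1).
have cv : (fun k => Lam nu c (fun x => f0 x * (G k x * cs b eta x))) @ \oo -->
    Lam nu c (fun x => f0 x * (g x * cs b eta x)).
  apply: (@Lam_cvg _ _ _ _ _ _ _ _ (A * B)) => [k|k x|x].
  - by apply: bmf3; have [] := hG k.
  - rewrite (_ : f0 x * _ = (f0 x * (1 * cs b eta x)) * G k x); last by ring.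
    by rewrite normrM ler_pM.
  - by apply: cvgMl_tmp; apply: cvgMr_tmp; exact: cG.
apply: (@cvg_unique _ _ ((fun k => Lam nu c (fun x => f0 x * (G k x * cs b eta x))) @ \oo)) => //.
by apply: cvg_near_cst; apply: nearW => k; exact: (hG k).2.
Qed.

Lemma multiplier_cst k : multiplier (fun=> k).
Proof. by split; [exact: bmf_cst|move=> g; exact: annihilatedZ]. Qed.

Lemma multiplierD m m' : multiplier m -> multiplier m' -> multiplier (fun x => m x + m' x).
Proof.
move=> [bm hm] [bm' hm']; split; first exact: bmfD.
move=> g hg; have := annihilatedD (hm g hg) (hm' g hg).
by congr annihilated; apply/funext => x; rewrite mulrDl.
Qed.

Lemma multiplierM m m' : multiplier m -> multiplier m' -> multiplier (fun x => m x * m' x).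
Proof.
move=> [bm hm] [bm' hm']; split; first exact: bmfM.
move=> g hg; have := hm _ (hm' g hg).
by congr annihilated; apply/funext => x; rewrite mulrA.
Qed.

Lemma multiplierB m m' : multiplier m -> multiplier m' -> multiplier (fun x => m x - m' x).
Proof.
move=> hm hm'; have := multiplierD hm (multiplierM (multiplier_cst (-1)) hm').
by congr multiplier; apply/funext => x; rewrite mulN1r.
Qed.

Lemma multiplierX m k : multiplier m -> multiplier (fun x => m x ^+ k).
Proof.
move=> hm; elim: k => [|k IH]; first exact: multiplier_cst.
by under eq_fun do rewrite exprS; exact: multiplierM.
Qed.

Lemma multiplier_prod (I : Type) (s : seq I) (F : I -> @Rn R n -> R) :
  (forall i, multiplier (F i)) -> multiplier (fun x => \prod_(i <- s) F i x).
Proof.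
move=> hF; elim: s => [|i s IH].
  by under eq_fun do rewrite big_nil; exact: multiplier_cst.
by under eq_fun do rewrite big_cons; exact: multiplierM.
Qed.

Lemma multiplier_cvg (G : nat -> @Rn R n -> R) g (B : R) : (forall k, multiplier (G k)) ->
  (forall k x, `|G k x| <= B) -> (forall x, G ^~ x @ \oo --> g x) -> multiplier g.
Proof.
move=> hG hB cG; split; first by apply: (bmf_cvg _ hB cG) => k; have [] := hG k.
move=> h hh; have [_ [A hA]] := hh.1.
apply: (@annihilated_cvg (fun k x => G k x * h x) _ (B * A)) => [k|k x|x].
- exact: (hG k).2.
- by rewrite normrM ler_pM.
- by apply: cvgMr_tmp; exact: cG.
Qed.

Lemma multiplier_cs b eta : multiplier (cs b eta).
Proof.
split; first exact: bmf_cs.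
move=> g [bg hg]; split; first exact: bmfM (bmf_cs _ _) _.
move=> b' zeta; set k1 : R := if b && b' then -1 else 1; set k2 : R := if ~~ b && b' then -1 else 1.
rewrite (@eq_Lam _ _ _ _ _ _ _ (fun x => 2^-1 * k1 * (f0 x * (g x * cs (b (+) b') (eta + zeta) x))
    + 2^-1 * k2 * (f0 x * (g x * cs (b (+) b') (eta - zeta) x)))).
  rewrite LamD ?LamZ ?hg ?mulr0 ?addr0//; try exact: bmf3.
  - by apply: bmfZ; exact: bmf3.
  - by apply: bmfZ; exact: bmf3.
move=> x; have -> : f0 x * (cs b eta x * g x * cs b' zeta x)
  = f0 x * g x * (cs b eta x * cs b' zeta x) by ring.
by rewrite csM -/k1 -/k2; ring.
Qed.

(** The step polynomials applied to (1 + sin (th (x_i - a))) / 2 converge to the indicator of a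
    negative sine. With [th = 1 / (k + 1)] the angle eventually lies in [-1, 1], where the sine has
    the sign of x_i - a. *)
Lemma multiplier_lt (i : 'I_n) (a : R) : multiplier (fun x => ((x ord0 i < a)%R : nat)%:R).
Proof.
have S (th : R) : multiplier (fun x : @Rn R n => ((sin (th * (x ord0 i - a)) < 0)%R : nat)%:R).
  pose t (x : @Rn R n) : R := (1 + sin (th * (x ord0 i - a))) / 2.
  pose e : 'rV[R]_n := \row_j (if j == i then th else 0).
  have de (x : @Rn R n) : dotR e x = th * x ord0 i.
    rewrite /dotR (bigD1 i)//= big1 ?addr0 ?mxE ?eqxx// => j ji.
    by rewrite mxE (negbTE ji) mul0r.
  have tE x : t x = 2^-1 * (1 + (cos (th * a) * cs true e x - sin (th * a) * cs false e x)).
    by rewrite /t /cs /= de mulrBr sinB; field.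
  have mt : multiplier t.
    have -> : t = (fun x => 2^-1 * (1 + (cos (th * a) * cs true e x - sin (th * a) * cs false e x))).
      by apply/funext.
    apply: multiplierM (multiplier_cst _) _; apply: multiplierD (multiplier_cst _) _.
    by apply: multiplierB; apply: multiplierM (multiplier_cst _) (multiplier_cs _ _).
  have t01 x : 0 <= t x <= 1.
    have := sin_le1 (th * (x ord0 i - a)); have := sin_geN1 (th * (x ord0 i - a)).
    by rewrite /t => ? ?; apply/andP; split; lra.
  apply: (@multiplier_cvg (fun k x => (1 - t x ^+ k) ^+ (k * 2 ^ k)) _ 1) => [k|k x|x].
  - by apply: multiplierX; apply: multiplierB (multiplier_cst _) _; exact: multiplierX.
  - have /andP[h0 h1] := t01 x.
    have k0 : 0 <= 1 - t x ^+ k by rewrite subr_ge0 exprn_ile1.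
    by rewrite ger0_norm ?exprn_ge0// exprn_ile1// gerBl exprn_ge0.
  - have := step_poly_cvg (t01 x).
    suff -> : (t x < 2^-1) = (sin (th * (x ord0 i - a)) < 0) by [].
    by rewrite /t; apply/idP/idP; lra.
apply: (@multiplier_cvg
  (fun k x => ((sin (k.+1%:R^-1 * (x ord0 i - a)) < 0)%R : nat)%:R) _ 1) => [k|k x|x].
- exact: S.
- by rewrite ger0_norm// lern1 leq_b1.
- apply: cvg_near_cst; near=> k.
  have hk : `|x ord0 i - a| <= k.+1%:R.
    apply: (@le_trans _ _ k%:R); first by near: k; exact: nbhs_infty_ger.
    by rewrite ler_nat.
  set y := k.+1%:R^-1 * (x ord0 i - a).
  have p2 := @pi_ge2 R.
  have k0 : 0 < k.+1%:R^-1 :> R by rewrite invr_gt0.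
  have y1 : `|y| <= 1 by rewrite normrM ger0_norm ?(ltW k0)// mulrC ler_pdivrMr ?mul1r.
  have -> : (x ord0 i < a) = (y < 0) by rewrite /y pmulr_rlt0// subr_lt0.
  congr ((nat_of_bool _)%:R); move: y1; rewrite ler_norml => /andP[y1 y2].
  have [y0|y0] := ltP y 0.
    by rewrite -[y]opprK sinN oppr_lt0 sin_gt0_pi//; apply/andP; split; lra.
  by apply/negbTE; rewrite -leNgt sin_ge0_pi//; apply/andP; split; lra.
Unshelve. all: by end_near. Qed.

Definition charf (A : set (@Rn R n)) (x : @Rn R n) : R := (`[< A x >] : nat)%:R.

Lemma charf_norm A x : `|charf A x| <= 1.
Proof. by rewrite ger0_norm// lern1 leq_b1. Qed.

Lemma sigma_algebra_multiplier : sigma_algebra setT [set A | multiplier (charf A)].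
Proof.
split => /=.
- rewrite (_ : charf set0 = fun=> 0); first exact: multiplier_cst.
  by apply/funext => x; rewrite /charf asboolF.
- move=> A mA; rewrite (_ : charf _ = fun x => 1 - charf A x);
    first exact: multiplierB (multiplier_cst _) mA.
  apply/funext => x; rewrite /charf setTD; have [Ax|Ax] := pselect (A x).
    by rewrite (asboolT Ax) asboolF ?subrr//; exact.
  by rewrite (asboolF Ax) asboolT ?subr0.
move=> A mA.
have P k x : \prod_(i < k) (1 - charf (A i) x) = 1 - charf (\bigcup_(i in [set i | (i < k)%N]) A i) x.
  have [[i ik Ai]|h] := pselect ((\bigcup_(i in [set i | (i < k)%N]) A i) x).
    rewrite [charf (\bigcup_(_ in _) _) x]/charf asboolT; last by exists i.
    rewrite subrr; apply/eqP; rewrite prodf_seq_eq0; apply/hasP.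
    exists (Ordinal ik); first exact: mem_index_enum.
    by rewrite /= /charf asboolT// subrr.
  rewrite [charf (\bigcup_(_ in _) _) x]/charf asboolF// subr0 big1// => i _.
  by rewrite /charf asboolF ?subr0// => Ai; apply: h; exists i => /=.
apply: (@multiplier_cvg (fun k x => 1 - \prod_(i < k) (1 - charf (A i) x)) _ 1) => [k|k x|x].
- apply: multiplierB (multiplier_cst _) _; apply: multiplier_prod => i.
  exact: multiplierB (multiplier_cst _) (mA i).
- by rewrite P opprB addrC subrK charf_norm.
- have [[i _ Ai]|h] := pselect ((\bigcup_k A k) x); apply: cvg_near_cst.
    near=> k; rewrite P opprB addrC subrK /charf !asboolT//; first by exists i.
    by exists i => //=; near: k; exact: nbhs_infty_gt.
  apply: nearW => k; rewrite P opprB addrC subrK /charf !asboolF//.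
  by move=> [i _ Ai]; apply: h; exists i.
Unshelve. all: by end_near. Qed.

Let box (q : 'rV[rat]_n) (k : nat) : set (@Rn R n) :=
  [set y | forall i, ratr (q ord0 i) - k.+1%:R^-1 <= y ord0 i < ratr (q ord0 i) + k.+1%:R^-1].

Lemma multiplier_box q k : multiplier (charf (box q k)).
Proof.
rewrite (_ : charf _ = fun x => \prod_(i < n) (((x ord0 i < ratr (q ord0 i) + k.+1%:R^-1)%R : nat)%:R *
   (1 - ((x ord0 i < ratr (q ord0 i) - k.+1%:R^-1)%R : nat)%:R))).
  apply: multiplier_prod => i; apply: multiplierM (multiplier_lt _ _) _.
  exact: multiplierB (multiplier_cst _) (multiplier_lt _ _).
apply/funext => x; have [h|h] := pselect (box q k x).
  rewrite /charf asboolT// big1// => i _; have /andP[h1 ->] := h i.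
  by rewrite ltNge h1 subr0 mulr1.
rewrite /charf asboolF//; apply/esym/eqP; rewrite prodf_seq_eq0.
have /existsNP[i hi] := h; apply/hasP; exists i; first exact: mem_index_enum.
move: hi => /negP; rewrite negb_and -ltNge => /orP[->|/negbTE ->]; last by rewrite /= mul0r.
by rewrite /= subrr mulr0.
Qed.

Lemma multiplier_measurable (A : set (@Rn R n)) : measurable A -> multiplier (charf A).
Proof.
move: A; apply: smallest_sub; first exact: sigma_algebra_multiplier.
move=> U oU /=.
(* An enumeration of the rational boxes in which those not contained in [U] are replaced by the
   empty set. *)
pose C (j : nat) : set (@Rn R n) := if unpickle j is Some (q, k)
  then (if `[< box q k `<=` U >] then box q k else set0) else set0.
suff -> : U = \bigcup_j C j.
  have [_ _] := sigma_algebra_multiplier; apply=> j; rewrite /C.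
  have m0 : multiplier (charf set0) by have [] := sigma_algebra_multiplier.
  case: unpickle => [[q k]|//]; case: asboolP => // _; exact: multiplier_box.
apply/seteqP; split => [x Ux|x [j _]]; last first.
  by rewrite /C; case: unpickle => [[q k]|//]; case: asboolP => // s /s.
have /nbhs_ballP[e /= e0 eU] : nbhs x U by exact: open_nbhs_nbhs.
(* Points of the box are within [de] of [q], and [q] is within [de] of [x], so [2 * de < e] keeps
   the box in the ball. *)
pose k := Num.truncn (2 / e); pose de : R := k.+1%:R^-1.
have de0 : 0 < de by rewrite invr_gt0.
have dee : 2 * de < e.
  have : 2 / e < k.+1%:R by rewrite truncnS_gt.
  by rewrite ltr_pdivrMr// => h; rewrite /de ltr_pdivrMr// mulrC.
have Q i : exists q : rat, x ord0 i < ratr q < x ord0 i + de.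
  have [q] := @rat_in_itvoo R (x ord0 i) (x ord0 i + de) ltac:(by rewrite ltrDl).
  by rewrite in_itv => h; exists q.
pose q : 'rV[rat]_n := \row_i sval (cid (Q i)).
have qP i : x ord0 i < ratr (q ord0 i) < x ord0 i + de by rewrite mxE; case: cid.
exists (pickle (q, k)) => //; rewrite /C pickleK asboolT => [i|y hy].
  by have := qP i; rewrite -/de => /andP[? ?]; apply/andP; split; lra.
apply: eU; split=> // i j; rewrite (ord1 i); have := qP j; have := hy j; rewrite -/de /ball/=.
by move=> /andP[? ?] /andP[? ?]; rewrite ltr_norml; apply/andP; split; lra.
Qed.

Lemma Lam_charf_eq0 (A : set (@Rn R n)) : measurable A -> Lam nu c (fun x => f0 x * charf A x) = 0.
Proof.
move=> mA; have [_ /(_ _ annihilated1)[_ /(_ false 0)]] := multiplier_measurable mA.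
move=> <-; apply: eq_Lam => x; rewrite /cs /dotR big1 ?cos0 ?mulr1// => i _.
by rewrite mxE mul0r.
Qed.

End Uniqueness.

(** * Euclidean norms and Hausdorff coverings *)

Section EuclideanNorm.
Context {R : realType} {n : nat}.
Implicit Types x y : 'rV[R]_n.

Definition l1norm x : R := \sum_i `|x ord0 i|.

Lemma l1norm_ge0 x : 0 <= l1norm x.
Proof. exact: sumr_ge0. Qed.

Lemma enorm_ge0 x : 0 <= enorm x.
Proof. exact: sqrtr_ge0. Qed.

Lemma enorm_sqr x : enorm x ^+ 2 = \sum_i x ord0 i ^+ 2.
Proof. by rewrite sqr_sqrtr// sumr_ge0// => i _; rewrite sqr_ge0. Qed.

Lemma coord_le_enorm x i : `|x ord0 i| <= enorm x.
Proof.
rewrite -sqrtr_sqr ler_wsqrtr// (bigD1 i)//= lerDl sumr_ge0// => j _.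
by rewrite sqr_ge0.
Qed.

Lemma l1norm_le x : l1norm x <= n%:R * enorm x.
Proof.
apply: (@le_trans _ _ (\sum_(i < n) enorm x)); first by apply: ler_sum => i _; exact: coord_le_enorm.
by rewrite sumr_const card_ord mulr_natl.
Qed.

Lemma sum_sqr_le (I : Type) (s : seq I) (a : I -> R) : (forall i, 0 <= a i) ->
  \sum_(i <- s) a i ^+ 2 <= (\sum_(i <- s) a i) ^+ 2.
Proof.
move=> a0; elim: s => [|i s IH]; first by rewrite !big_nil expr0n.
rewrite !big_cons; have S0 : 0 <= \sum_(j <- s) a j by exact: sumr_ge0.
have := mulr_ge0 (a0 i) S0; move: IH; set A := \sum_(j <- s) a j ^+ 2; set B := \sum_(j <- s) a j.
by rewrite sqrrD; lra.
Qed.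

Lemma enorm_le_l1 x : enorm x <= l1norm x.
Proof.
rewrite -[leRHS]ger0_norm ?l1norm_ge0// -sqrtr_sqr ler_wsqrtr//.
under eq_bigr do rewrite -real_normK ?num_real//.
exact: sum_sqr_le.
Qed.

Lemma enorm0 : enorm (0 : 'rV[R]_n) = 0.
Proof. by rewrite /enorm big1 ?sqrtr0// => i _; rewrite mxE expr0n. Qed.

Lemma enorm_gt0 x : x != 0 -> 0 < enorm x.
Proof.
move=> x0; rewrite lt_neqAle enorm_ge0 andbT eq_sym; apply: contra x0 => /eqP e0.
apply/eqP/rowP => i; rewrite mxE; apply/eqP; rewrite -normr_le0 -e0; exact: coord_le_enorm.
Qed.

Lemma enormZ (a : R) x : enorm (a *: x) = `|a| * enorm x.
Proof.
rewrite /enorm -sqrtr_sqr -sqrtrM ?sqr_ge0// mulr_sumr; congr Num.sqrt.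
by apply: eq_bigr => i _; rewrite mxE exprMn.
Qed.

(** Multiplied by |x| + |y|, the left side is a difference of squares, which factors coordinate by
    coordinate; the l1 norm thus spares the Cauchy-Schwarz inequality. *)
Lemma enorm_dist x y : `|enorm x - enorm y| <= l1norm (x - y).
Proof.
have [x0|x0] := eqVneq x 0.
  rewrite x0 enorm0 sub0r normrN ger0_norm ?enorm_ge0// sub0r.
  apply: (le_trans (enorm_le_l1 y)); rewrite le_eqVlt; apply/orP; left; apply/eqP.
  by apply: eq_bigr => i _; rewrite mxE normrN.
have S0 : 0 < enorm x + enorm y by rewrite ltr_wpDr ?enorm_ge0 ?enorm_gt0.
rewrite -(ler_pM2r S0) -{1}(ger0_norm (ltW S0)) -normrM -subr_sqr !enorm_sqr -sumrB mulr_suml.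
apply: (le_trans (ler_norm_sum _ _ _)); apply: ler_sum => i _.
rewrite subr_sqr normrM !mxE; apply: ler_wpM2l => //.
by apply: (le_trans (ler_normD _ _)); apply: lerD; exact: coord_le_enorm.
Qed.

Lemma enorm_normalize x y : x != 0 -> y != 0 ->
  enorm ((enorm x)^-1 *: x - (enorm y)^-1 *: y) <= (1 + n%:R) * l1norm (x - y) / enorm y.
Proof.
move=> x0 y0; have ex := enorm_gt0 x0; have ey := enorm_gt0 y0.
apply: (le_trans (enorm_le_l1 _)).
have E i : `|((enorm x)^-1 *: x - (enorm y)^-1 *: y) ord0 i| <=
   (`|(x - y) ord0 i| + `|x ord0 i| / enorm x * l1norm (x - y)) / enorm y.
  rewrite !mxE; set a := x ord0 i; set b := y ord0 i.
  have -> : (enorm x)^-1 * a - (enorm y)^-1 * b =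
     ((a - b) + a / enorm x * (enorm y - enorm x)) / enorm y.
    by field; rewrite !gt_eqF.
  rewrite normrM [`|_^-1|]ger0_norm ?invr_ge0 ?enorm_ge0// ler_pM2r ?invr_gt0//.
  apply: (le_trans (ler_normD _ _)); rewrite lerD2l !normrM [`|_^-1|]ger0_norm ?invr_ge0 ?enorm_ge0//.
  by rewrite ler_wpM2l ?mulr_ge0 ?invr_ge0 ?enorm_ge0// distrC enorm_dist.
apply: (le_trans (ler_sum _ (fun i _ => E i))).
rewrite -mulr_suml ler_pM2r ?invr_gt0// big_split/= -mulr_suml -mulr_suml mulrDl mul1r.
rewrite lerD2l ler_wpM2r ?l1norm_ge0// ler_pdivrMr//; exact: l1norm_le.
Qed.

End EuclideanNorm.

(** [v1] and [v2] generate the frequency lattice of the torus. A right inverse of the basis matrix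
    recovers [k1] and [k2] linearly from the combination, and its entries give [K]. *)
Lemma span2 (R : realType) (n : nat) (V : 'M[R]_n) : \rank V = 2%N ->
  exists v1 v2 : 'rV[R]_n, exists2 K : R, 0 < K & forall k1 k2 : R,
    ((k1 *: v1 + k2 *: v2)%R <= V)%MS /\ `|k1| + `|k2| <= K * enorm (k1 *: v1 + k2 *: v2).
Proof.
move=> rk; pose B : 'M[R]_(2, n) := castmx (rk, erefl) (row_base V).
have Bf : row_free B by rewrite /B row_free_castmx row_base_free.
have BV : (B <= V)%MS by rewrite /B eqmx_cast eq_row_base.
have [B' BB'] := row_freeP Bf.
pose i0 : 'I_2 := ord0; pose i1 : 'I_2 := lift ord0 ord0.
pose K : R := 1 + \sum_j (`|B' j i0| + `|B' j i1|).
have K0 : 0 < K by rewrite ltr_wpDr// sumr_ge0// => j _; rewrite addr_ge0.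
exists (row i0 B), (row i1 B), K => // k1 k2; split.
  by apply: addmx_sub; apply: scalemx_sub; apply: submx_trans BV; exact: row_sub.
set xi := k1 *: _ + k2 *: _.
have X (i : 'I_2) : (xi *m B') ord0 i = k1 *+ (i0 == i) + k2 *+ (i1 == i).
  rewrite /xi mulmxDl -!scalemxAl -!row_mul BB' !mxE !mulr_natr; congr (_ + _).
have E (i : 'I_2) : `|(xi *m B') ord0 i| <= enorm xi * \sum_j `|B' j i|.
  rewrite mxE (le_trans (ler_norm_sum _ _ _))// mulr_sumr; apply: ler_sum => j _.
  by rewrite normrM ler_wpM2r// coord_le_enorm.
have := E i0; have := E i1; rewrite !X /= !mulr1n !mulr0n addr0 add0r => e1 e0.
apply: (le_trans (lerD e0 e1)); rewrite -mulrDr -big_split/= mulrC ler_wpM2r ?enorm_ge0//.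
by rewrite /K lerDr.
Qed.

(* The exponent is raised to at least 1 because, at [s = 0], radii enlarged to be
   positive would not have small [r `^ s]. *)
Lemma hausdorff_cover (R : realType) (n : nat) (F : set 'rV[R]_n) (s kappa e : R) :
  0 <= s -> hausdorff_measure s F = 0%E -> 0 < kappa -> 0 < e ->
  let s' := Num.max s 1 in
  exists (x : nat -> 'rV[R]_n) (r : nat -> R), [/\ (forall i, 0 < r i),
    (forall N, \sum_(i < N) r i `^ s' <= e) &
    (forall y, F y -> exists i, kappa * enorm (y - x i) <= r i)].
Proof.
move=> s0 H0 k0 e0 s'.
have s'1 : 1 <= s' by rewrite le_max lexx orbT.
have ss' : s <= s' by rewrite le_max lexx.
have s'0 : 0 < s' by apply: lt_le_trans s'1.
pose e' := e / (2 * kappa `^ s').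
have ks0 : 0 < kappa `^ s' by rewrite powR_gt0.
have e'0 : 0 < e' by rewrite divr_gt0// mulr_gt0.
(* Mesh 1 suffices: for diameters at most 1, raising the exponent from [s] to [s'] does not increase
   the cost. *)
have : (hcontent_delta s 1 F < e'%:E)%E.
  apply: (@le_lt_trans _ _ 0%E); last by rewrite lte_fin.
  by rewrite -H0; apply: ereal_sup_ubound; exists 1 => //=.
move=> /ereal_inf_lt[_ [U [FU Ud] <-]] Ue.
pose d i := fine (diam (U i)).
have d01 i y z : U i y -> U i z -> enorm (y - z) <= d i <= 1.
  move=> Uy Uz.
  have h1 : ((enorm (y - z))%:E <= diam (U i))%E.
    by apply: ereal_sup_ubound; exists y => //; exists z.
  have dfin : diam (U i) \is a fin_num.
    by rewrite fin_numE; apply/andP; split; apply/eqP => E; move: h1 (Ud i); rewrite E.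
  by rewrite -!lee_fin /d fineK// h1 Ud.
have hcE i : exists2 cst : R, hcost s (U i) = cst%:E & 0 <= cst /\ d i `^ s' <= cst.
  rewrite /hcost; case: asboolP => [U0|/eqP/set0P [y Uy]].
    exists 0 => //; split=> //; rewrite /d U0 /diam.
    rewrite (_ : [set _ | _ in _ & _ in _] = set0); last first.
      by apply/seteqP; split => // z [? []].
    by rewrite ereal_sup0 /= powR0// gt_eqF.
  exists (d i `^ s) => //; split; first exact: powR_ge0.
  have /andP[a b] := d01 i y y Uy Uy; have dd : 0 <= d i by apply: le_trans a; exact: enorm_ge0.
  have [->|dN0] := eqVneq (d i) 0; first by rewrite powR0 ?gt_eqF// powR_ge0.
  by apply: ger_powR; rewrite // lt_neqAle eq_sym dN0 dd.
have hc0 i : (0 <= hcost s (U i))%E by have [cc -> []] := hcE i; rewrite lee_fin.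
have dsum N : \sum_(i < N) d i `^ s' <= e'.
  rewrite -lee_fin; apply: le_trans (ltW Ue).
  apply: (@le_trans _ _ (\sum_(0 <= i < N) hcost s (U i))%E); last first.
    by apply: nneseries_lim_ge => i _ _.
  rewrite big_mkord -sumEFin; apply: lee_sum => i _.
  by have [cc -> [_]] := hcE i; rewrite lee_fin.
(* The added term keeps the radius positive when the diameter is 0. Its sum is at most [e'], the
   second half of the budget. *)
pose b i := kappa `^ s' * (d i `^ s' + e' * 2^-1 ^+ i.+1).
have b0 i : 0 < b i.
  by rewrite mulr_gt0// ltr_wpDl ?powR_ge0// mulr_gt0// exprn_gt0// invr_gt0.
pose r i := b i `^ s'^-1.
have rE i : r i `^ s' = b i by rewrite /r -powRrM mulVf ?gt_eqF// powRr1// ltW.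
(* The centre is any point of [U i]; the default 0 is taken only for an empty [U i], which covers
   nothing. *)
exists (fun i => xget 0 (U i)), r; split.
- by move=> i; rewrite powR_gt0.
- move=> N; under eq_bigr do rewrite rE.
  rewrite -mulr_sumr big_split/= -mulr_sumr.
  have g : \sum_(i < N) 2^-1 ^+ i.+1 <= 1 :> R.
    under eq_bigr do rewrite exprS.
    rewrite -mulr_sumr; have h0 : 0 < 2^-1 :> R by rewrite invr_gt0.
    have h1 : 2^-1 < 1 :> R by rewrite invf_lt1// ltr1n.
    have := @geometric_le R (2^-1) h0 h1 N.
    have -> : (1 - 2^-1)^-1 = 2 :> R by field.
    lra.
  apply: (@le_trans _ _ (kappa `^ s' * (e' + e'))).
    by apply: ler_wpM2l; [exact: ltW|apply: lerD; [exact: dsum|by rewrite ler_piMr// ltW]].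
  by rewrite /e' le_eqVlt; apply/orP; left; apply/eqP; field; rewrite gt_eqF.
- move=> y /FU [i _ Uiy]; exists i.
  have Ux : U i (xget 0 (U i)) by apply: xgetPex; exists y.
  have /andP[h1 _] := d01 _ _ _ Uiy Ux.
  have dd : 0 <= d i by apply: le_trans h1; exact: enorm_ge0.
  apply: (@le_trans _ _ (kappa * d i)); first by rewrite ler_pM2l.
  have kd : 0 <= kappa * d i by rewrite mulr_ge0// ltW.
  rewrite -[leLHS](powRr1 kd) -(mulfV (_ : s' != 0)) ?gt_eqF// powRrM.
  apply: ge0_ler_powR; rewrite ?invr_ge0 ?nnegrE ?powR_ge0 ?(ltW (b0 _)) ?(ltW s'0)//.
  rewrite powRM// ?(ltW k0)//; apply: ler_wpM2l; first exact: ltW.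
  by rewrite lerDl mulr_ge0 ?(ltW e'0)// exprn_ge0// invr_ge0.
Qed.

(** * Fourier decay along a plane *)

Section ComplexAbs.
Context {R : realType}.
Implicit Types z w : R[i].

(** A real-valued equivalent of the modulus, subadditive and submultiplicative. *)
Definition absRI z : R := `|complex.Re z| + `|complex.Im z|.

Lemma ReD z w : complex.Re (z + w) = complex.Re z + complex.Re w.
Proof. by case: z; case: w. Qed.

Lemma ImD z w : complex.Im (z + w) = complex.Im z + complex.Im w.
Proof. by case: z; case: w. Qed.

Lemma ReN z : complex.Re (- z) = - complex.Re z.
Proof. by case: z. Qed.

Lemma ImN z : complex.Im (- z) = - complex.Im z.
Proof. by case: z. Qed.

Lemma Re_mul z w : complex.Re (z * w) = complex.Re z * complex.Re w - complex.Im z * complex.Im w.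
Proof. by case: z; case: w. Qed.

Lemma Im_mul z w : complex.Im (z * w) = complex.Re z * complex.Im w + complex.Im z * complex.Re w.
Proof. by case: z; case: w. Qed.

Lemma Re_comb z1 z2 z3 z4 : complex.Re (z1 - z2 + 'i%C * (z3 - z4)) =
  complex.Re z1 - complex.Re z2 - (complex.Im z3 - complex.Im z4).
Proof. by case: z1; case: z2; case: z3; case: z4 => * /=; ring. Qed.

Lemma Im_comb z1 z2 z3 z4 : complex.Im (z1 - z2 + 'i%C * (z3 - z4)) =
  complex.Im z1 - complex.Im z2 + (complex.Re z3 - complex.Re z4).
Proof. by case: z1; case: z2; case: z3; case: z4 => * /=; ring. Qed.

Lemma Re_sum (I : Type) (s : seq I) (F : I -> R[i]) :
  complex.Re (\sum_(i <- s) F i) = \sum_(i <- s) complex.Re (F i).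
Proof. by apply: (big_morph _ ReD). Qed.

Lemma absRI_ge0 z : 0 <= absRI z.
Proof. exact: addr_ge0. Qed.

Lemma absRID z w : absRI (z + w) <= absRI z + absRI w.
Proof. by rewrite /absRI ReD ImD addrACA lerD// ler_normD. Qed.

Lemma absRIM z w : absRI (z * w) <= absRI z * absRI w.
Proof.
rewrite /absRI Re_mul Im_mul mulrDl !mulrDr -!normrM.
apply: (le_trans (lerD (ler_normB _ _) (ler_normD _ _))).
by rewrite le_eqVlt; apply/orP; left; apply/eqP; ring.
Qed.

Lemma absRI_sum (I : Type) (s : seq I) (F : I -> R[i]) :
  absRI (\sum_(i <- s) F i) <= \sum_(i <- s) absRI (F i).
Proof.
elim: s => [|i s IH]; first by rewrite !big_nil /absRI normr0 addr0.
by rewrite !big_cons (le_trans (absRID _ _))// lerD2l.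
Qed.

Lemma cnorm_le m (v : 'rV[R[i]]_m) : cnorm v <= \sum_j absRI (v ord0 j).
Proof.
have S0 : 0 <= \sum_j absRI (v ord0 j) by apply: sumr_ge0 => j _; exact: absRI_ge0.
rewrite -[leRHS]ger0_norm// -sqrtr_sqr ler_wsqrtr//.
apply: le_trans (sum_sqr_le _ _); last by move=> j; exact: absRI_ge0.
apply: ler_sum => j _; rewrite -[complex.Re _ ^+ 2]real_normK ?num_real//.
rewrite -[complex.Im _ ^+ 2]real_normK ?num_real// /absRI.
have : 0 <= `|complex.Re (v ord0 j)| * `|complex.Im (v ord0 j)| by rewrite mulr_ge0.
set a := `|complex.Re _|; set b := `|complex.Im _|.
by rewrite sqrrD; lra.
Qed.

Lemma absRI_le_cnorm m (v : 'rV[R[i]]_m) j : absRI (v ord0 j) <= 2 * cnorm v.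
Proof.
have h (f : R[i] -> R) : (forall z, f z ^+ 2 <= complex.Re z ^+ 2 + complex.Im z ^+ 2) ->
    `|f (v ord0 j)| <= cnorm v.
  move=> hf; rewrite -sqrtr_sqr ler_wsqrtr// (bigD1 j)//= (le_trans (hf _))// lerDl.
  by apply: sumr_ge0 => k _; rewrite addr_ge0 ?sqr_ge0.
rewrite mulr_natl mulr2n lerD// h// => z; first by rewrite lerDl sqr_ge0.
by rewrite lerDr sqr_ge0.
Qed.

Lemma absRI_le_opnorm m (A : 'M[R[i]]_m) i j : absRI (A i j) <= 2 * opnorm A.
Proof.
apply: (@le_trans _ _ (2 * cnorm (row i A))).
  by have := absRI_le_cnorm (row i A) j; rewrite mxE.
rewrite ler_pM2l// /opnorm; apply: ub_le_sup; last first.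
  exists (delta_mx 0 i); last by rewrite -rowE.
  rewrite /= /cnorm (bigD1 i)//= big1 ?addr0 => [|k ki].
    by rewrite mxE !eqxx /= expr1n expr0n addr0 sqrtr1.
  by rewrite mxE (negbTE ki) andbF /= expr0n addr0.
(* [sup] dominates the members of its set only once the set is known to be bounded above. *)
exists (\sum_j \sum_i 2 * absRI (A i j)) => _ [x /= x1 <-].
apply: (le_trans (cnorm_le _)); apply: ler_sum => k _; rewrite mxE.
apply: (le_trans (absRI_sum _ _)); apply: ler_sum => l _.
apply: (le_trans (absRIM _ _)); apply: ler_wpM2r; first exact: absRI_ge0.
apply: (le_trans (absRI_le_cnorm _ _)); by rewrite -[leRHS]mulr1 ler_pM2l.
Qed.

End ComplexAbs.

Arguments cs : simpl never.

Section Pairing.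
Context {R : realType} (n m : nat) (mu : @vmeasure R n m).
Implicit Types (w : 'cV[R[i]]_m) (xi : 'rV[R]_n) (f : @Rn R n -> R).

Definition vparts (t : 'I_m * bool * bool) : {finite_measure set (@Rn R n) -> \bar R} :=
  if t.1.2 then (if t.2 then im_neg mu t.1.1 else im_pos mu t.1.1)
  else (if t.2 then re_neg mu t.1.1 else re_pos mu t.1.1).

(** The first boolean selects the imaginary part of mu, the second the negative part of the Jordan
    decomposition. The sign before [complex.Im] is that of Re ((a + ib)(u + iv)) = au - bv. *)
Definition vcoef w (t : 'I_m * bool * bool) : R :=
  (if t.2 then -1 else 1) * (if t.1.2 then - complex.Im (w t.1.1 ord0) else complex.Re (w t.1.1 ord0)).

(* The real part of the pairing of [mu] with [f] and [w]. *)
Definition Lre w f : R := Lam vparts (vcoef w) f.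

Lemma LreE w f : Lre w f = \sum_k
  (complex.Re (w k ord0) * ((\int[re_pos mu k]_x f x) - \int[re_neg mu k]_x f x)
  - complex.Im (w k ord0) * ((\int[im_pos mu k]_x f x) - \int[im_neg mu k]_x f x)).
Proof.
rewrite /Lre /Lam -(pair_big xpredT xpredT (fun (ki : 'I_m * bool) (s : bool) =>
   vcoef w (ki, s) * \int[vparts (ki, s)]_x f x))/=.
rewrite -(pair_big xpredT xpredT (fun (k : 'I_m) (i : bool) =>
   \sum_(s : bool) vcoef w (k, i, s) * \int[vparts (k, i, s)]_x f x))/=.
by apply: eq_bigr => k _; rewrite !big_bool /vcoef /vparts/=; ring.
Qed.

Definition pairing w xi : R[i] := (vfourier mu xi *m w) ord0 ord0.

(** The column -i w, whose real pairing is the imaginary pairing of w; it lets the whole argument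
    run on real parts. *)
Definition rotw w : 'cV[R[i]]_m := (Complex 0 (-1)) *: w.

Lemma Re_rotw w k : complex.Re (rotw w k ord0) = complex.Im (w k ord0).
Proof. by rewrite mxE Re_mul /= mul0r mulN1r opprK add0r. Qed.

Lemma Im_rotw w k : complex.Im (rotw w k ord0) = - complex.Re (w k ord0).
Proof. by rewrite mxE Im_mul /= mul0r mulN1r add0r. Qed.

Lemma dotRZ (a : R) xi (x : @Rn R n) : dotR (a *: xi) x = a * dotR xi x.
Proof. by rewrite /dotR mulr_sumr; apply: eq_bigr => i _; rewrite mxE mulrA. Qed.

Lemma Re_pairing w xi : complex.Re (pairing w xi) =
  Lre w (cs false ((2 * pi) *: xi)) + Lre (rotw w) (cs true ((2 * pi) *: xi)).
Proof.
rewrite /pairing mxE Re_sum !LreE -big_split/=; apply: eq_bigr => k _.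
rewrite Re_rotw Im_rotw Re_mul mxE.
have Ec (nu : {finite_measure set (@Rn R n) -> \bar R}) :
  complex.Re (cfourier nu xi) = \int[nu]_x cs false ((2 * pi) *: xi) x.
  rewrite /cfourier ReD ReN Re_mul /= mul0r mulr0 subrr subr0 /Rintegral.
  by congr fine; apply: eq_integral => x _; rewrite /cs dotRZ.
have Es (nu : {finite_measure set (@Rn R n) -> \bar R}) :
  complex.Im (cfourier nu xi) = - \int[nu]_x cs true ((2 * pi) *: xi) x.
  rewrite /cfourier ImD ImN Im_mul /= mul0r mul1r !add0r /Rintegral.
  by congr (- fine _); apply: eq_integral => x _; rewrite /cs dotRZ.
by rewrite Re_comb Im_comb !Ec !Es; ring.
Qed.

Lemma Re_vmeas w (A : set (@Rn R n)) : measurable A ->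
  complex.Re ((vmeas mu A *m w) ord0 ord0) = Lre w (charf A).
Proof.
move=> mA; rewrite mxE Re_sum LreE; apply: eq_bigr => k _.
have E (nu : {finite_measure set (@Rn R n) -> \bar R}) : \int[nu]_x charf A x = fine (nu A).
  have -> : charf A = \1_A.
    apply/funext => x; rewrite /charf indicE; have [h|h] := pselect (A x).
      by rewrite asboolT// mem_set.
    by rewrite asboolF// memNset.
  by rewrite /Rintegral integral_indic// setIT.
by rewrite mxE Re_mul !E Re_comb Im_comb /cval /=; ring.
Qed.

Lemma Im_eq_Re_rotw (v : 'rV[R[i]]_m) w :
  complex.Im ((v *m w) ord0 ord0) = complex.Re ((v *m rotw w) ord0 ord0).
Proof. by rewrite -scalemxAr [in RHS]mxE Re_mul /=; ring. Qed.

Lemma Lam_le_mass w : exists2 B : R, 0 <= B &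
  forall f, measurable_fun setT f -> (forall x, `|f x| <= 1) -> `|Lre w f| <= B.
Proof.
exists (\sum_t `|vcoef w t| * fine (vparts t setT)).
  by apply: sumr_ge0 => t _; rewrite mulr_ge0// fine_ge0.
move=> f mf f1; have bf : bmf f by split => //; exists 1.
rewrite /Lre /Lam (le_trans (ler_norm_sum _ _ _))//; apply: ler_sum => t _.
rewrite normrM ler_wpM2l//.
apply: (le_trans (le_normr_Rintegral _ _)) => //; first exact: bmf_integrable.
rewrite -[leRHS]mul1r -Rintegral_cst//; apply: le_Rintegral => //.
- apply: (@bmf_integrable _ _ _ _ vparts (fun x => `|f x|)); split.
    by apply: measurableT_comp => //; exact: measurable_normr.
  by exists 1 => x; rewrite normr_id.
- exact: (@bmf_integrable _ _ _ _ vparts (fun=> 1) t (bmf_cst 1)).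
Qed.

Lemma pairing_bounded w : exists2 B : R, 0 <= B & forall xi, `|complex.Re (pairing w xi)| <= B.
Proof.
have [B1 B10 h1] := Lam_le_mass w; have [B2 B20 h2] := Lam_le_mass (rotw w).
exists (B1 + B2); first exact: addr_ge0.
move=> xi; rewrite Re_pairing (le_trans (ler_normD _ _))// lerD//.
- by apply: h1 => [|x]; [exact: (bmf_cs _ _).1|exact: cos_max].
- by apply: h2 => [|x]; [exact: (bmf_cs _ _).1|exact: sin_max].
Qed.

Lemma vfourier_bounded : exists2 B : R, 0 <= B & forall xi k, absRI (vfourier mu xi ord0 k) <= B.
Proof.
pose e k : 'cV[R[i]]_m := delta_mx k 0.
have E k xi : vfourier mu xi ord0 k = pairing (e k) xi.
  by rewrite /pairing /e -colE [RHS]mxE.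
have Im_pairing w xi : complex.Im (pairing w xi) = complex.Re (pairing (rotw w) xi).
  exact: Im_eq_Re_rotw.
pose B k := sval (cid2 (pairing_bounded (e k))); pose B' k := sval (cid2 (pairing_bounded (rotw (e k)))).
have hB k : 0 <= B k /\ forall xi, `|complex.Re (pairing (e k) xi)| <= B k.
  by rewrite /B; case: cid2.
have hB' k : 0 <= B' k /\ forall xi, `|complex.Re (pairing (rotw (e k)) xi)| <= B' k.
  by rewrite /B'; case: cid2.
have S0 k : 0 <= B k + B' k by rewrite addr_ge0 ?(hB k).1 ?(hB' k).1.
exists (\sum_k (B k + B' k)); first by apply: sumr_ge0.
move=> xi k; apply: (@le_trans _ _ (B k + B' k)).
  by rewrite E /absRI Im_pairing lerD ?(hB k).2 ?(hB' k).2.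
by rewrite (bigD1 k)//= lerDl sumr_ge0.
Qed.

End Pairing.

Section BundleDecay.
Context {R : realType} (n m : nat) (phi : 'rV[R]_n -> 'M[R[i]]_m) (mu : @vmeasure R n m).
Context (v1 v2 : 'rV[R]_n) (K : R) (W : 'M[R[i]]_m).
Hypotheses (phi_bundle : homogeneous_line_bundle phi) (phi_lip : lipschitz_on_sphere phi).
Hypothesis mu_phi : in_M_phi phi mu.
Hypotheses (K0 : 0 < K).
Hypothesis phiW : forall k1 k2, k1 *: v1 + k2 *: v2 != 0 -> (phi (k1 *: v1 + k2 *: v2)%R <= W)%MS.
Hypothesis vK : forall k1 k2, `|k1| + `|k2| <= K * enorm (k1 *: v1 + k2 *: v2).

(** The projection [phi zeta] fixes the Fourier transform at [zeta] and [phi xi] kills [w], so the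
    pairing only sees [phi zeta - phi xi]. Homogeneity moves both points to the sphere, where the
    Lipschitz bound applies. *)
Lemma pairing_decay (w : 'cV[R[i]]_m) (eta : 'rV[R]_n) : W *m w = 0 ->
  exists2 C : R, 0 <= C & forall k1 k2,
    `|complex.Re (pairing mu w (k1 *: v1 + k2 *: v2 + eta))| <= C / (1 + `|k1| + `|k2|).
Proof.
move=> Ww; have [hproj hhom _] := phi_bundle; have [L hL] := phi_lip.
have [B B0 hB] := vfourier_bounded mu; have [M M0 hM] := pairing_bounded mu w.
pose S := \sum_j absRI (w j ord0).
have S0 : 0 <= S by apply: sumr_ge0 => j _; exact: absRI_ge0.
pose A := m%:R * (B * (2 * (`|L| * ((1 + n%:R) * l1norm eta)))) * S.
have A0 : 0 <= A by rewrite /A !mulr_ge0// ?l1norm_ge0// addr_ge0.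
have main xi : xi != 0 -> (phi xi <= W)%MS -> xi + eta != 0 ->
    `|complex.Re (pairing mu w (xi + eta))| <= A / enorm xi.
  move=> xi0 xiW zeta0; set zeta := xi + eta.
  have ez := enorm_gt0 zeta0; have ex := enorm_gt0 xi0.
  have [PP _] := hproj _ zeta0.
  have [X XE] := submxP (mu_phi zeta0); have [Y YE] := submxP xiW.
  have phiw : phi xi *m w = 0 by rewrite YE -mulmxA Ww mulmx0.
  have fixv : vfourier mu zeta *m phi zeta = vfourier mu zeta by rewrite XE -mulmxA PP.
  pose D := phi zeta - phi xi.
  have ZE : pairing mu w zeta = ((vfourier mu zeta *m D) *m w) ord0 ord0.
    by rewrite /D mulmxBr fixv mulmxBl -(mulmxA _ (phi xi)) phiw mulmx0 subr0.
  have gd : opnorm D <= `|L| * ((1 + n%:R) * l1norm eta) / enorm xi.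
    rewrite -/(gdist _ _).
    rewrite -(hhom zeta (enorm zeta)^-1)// ?invr_gt0// -(hhom xi (enorm xi)^-1)// ?invr_gt0//.
    have u1 (x : 'rV[R]_n) : 0 < enorm x -> enorm ((enorm x)^-1 *: x) = 1.
      by move=> x0; rewrite enormZ ger0_norm ?invr_ge0 ?(ltW x0)// mulVf// gt_eqF.
    apply: (le_trans (hL _ _ (u1 _ ez) (u1 _ ex))).
    apply: (@le_trans _ _ (`|L| * enorm ((enorm zeta)^-1 *: zeta - (enorm xi)^-1 *: xi))).
      by rewrite ler_wpM2r ?enorm_ge0// ler_norm.
    rewrite -mulrA ler_wpM2l//.
    have := enorm_normalize zeta0 xi0; rewrite (_ : zeta - xi = eta)//.
    by rewrite /zeta addrAC subrr add0r.
  apply: (@le_trans _ _ (absRI (pairing mu w zeta))); first by rewrite lerDl.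
  rewrite ZE mxE; apply: (le_trans (absRI_sum _ _)).
  apply: (@le_trans _ _ (\sum_j m%:R * (B * (2 * opnorm D)) * absRI (w j ord0))).
    apply: ler_sum => j _; apply: (le_trans (absRIM _ _)); apply: ler_wpM2r; first exact: absRI_ge0.
    rewrite mxE; apply: (le_trans (absRI_sum _ _)).
    apply: (@le_trans _ _ (\sum_(i < m) B * (2 * opnorm D))).
      apply: ler_sum => i _; apply: (le_trans (absRIM _ _)).
      by apply: ler_pM; rewrite ?absRI_ge0// absRI_le_opnorm.
    by rewrite sumr_const card_ord [in leRHS]mulr_natl.
  have -> : A / enorm xi = m%:R * (B * (2 * (`|L| * ((1 + n%:R) * l1norm eta) / enorm xi))) * S.
    by rewrite /A; field; rewrite gt_eqF.
  rewrite -mulr_sumr -/S; apply: ler_wpM2r => //; apply: ler_wpM2l => //.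
  by apply: ler_wpM2l => //; apply: ler_wpM2l.
have T1 : 0 <= M * (1 + K * enorm eta).
  by rewrite mulr_ge0// addr_ge0// mulr_ge0 ?enorm_ge0// ltW.
have T2 : 0 <= 2 * A * K by apply: mulr_ge0; [exact: mulr_ge0|exact: ltW].
(* The first term is for [xi = - eta], where no line is available; the second for
   [|k1| + |k2| <= 1]; the third for the rest, where 1 + t <= 2t <= 2 K |xi|. *)
exists (M * (1 + K * enorm eta) + 2 * M + 2 * A * K).
  by rewrite addr_ge0// addr_ge0// mulr_ge0.
move=> k1 k2; have := vK k1 k2; set xi := k1 *: v1 + k2 *: v2 => q.
set Z := `|_|; have ZM : Z <= M by exact: hM.
have Z0 : 0 <= Z by exact: normr_ge0.
have q0 : 0 <= `|k1| + `|k2| by rewrite addr_ge0.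
rewrite -(addrA 1); set t := `|k1| + `|k2| in q q0 *.
rewrite ler_pdivlMr; last by rewrite ltr_wpDr.
have [xi0|xi0] := eqVneq xi 0.
  rewrite xi0 enorm0 mulr0 in q; have -> : t = 0 by apply/eqP; rewrite eq_le q q0.
  by rewrite addr0 mulr1; lra.
have [ze|ze] := eqVneq (xi + eta) 0.
  have E : enorm xi = enorm eta.
    rewrite (_ : xi = (-1) *: eta) ?enormZ ?normrN1 ?mul1r// scaleN1r.
    by apply/eqP; rewrite -addr_eq0 ze.
  apply: (@le_trans _ _ (M * (1 + K * enorm eta))); last by lra.
  by apply: ler_pM => //; rewrite ?addr_ge0// lerD2l -E.
have [t1|t1] := leP t 1.
  apply: (@le_trans _ _ (M * 2)); last by lra.
  by apply: ler_pM => //; rewrite ?addr_ge0//; lra.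
have hZ := main xi xi0 (phiW xi0) ze; rewrite -/Z in hZ.
have ex := enorm_gt0 xi0.
apply: (@le_trans _ _ (A / enorm xi * (2 * (K * enorm xi)))).
  apply: ler_pM => //; first by rewrite addr_ge0.
  by lra.
have -> : A / enorm xi * (2 * (K * enorm xi)) = 2 * A * K by field; rewrite gt_eqF.
by lra.
Qed.

(** The real pairing is a cosine integral for w plus a sine integral for -i w. Its values at
    opposite frequencies separate the two by parity; the sine integral for w is then obtained from i
    w. *)
Lemma cs_decay (w : 'cV[R[i]]_m) (b : bool) (eta : 'rV[R]_n) : W *m w = 0 ->
  exists2 C : R, 0 <= C & forall k1 k2,
    `|Lre mu w (cs b ((2 * pi) *: (k1 *: v1 + k2 *: v2 + eta)))| <= C / (1 + `|k1| + `|k2|).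
Proof.
move=> Ww.
have dN (xi : 'rV[R]_n) (x : @Rn R n) : dotR (- xi) x = - dotR xi x.
  by rewrite -scaleN1r dotRZ mulN1r.
have LN w' xi : Lre mu w' (cs true ((2 * pi) *: (- xi))) = - Lre mu w' (cs true ((2 * pi) *: xi)).
  rewrite -mulN1r /Lre -LamZ; last exact: bmf_cs.
  by apply: eq_Lam => x; rewrite /cs scalerN dN sinN mulN1r.
have LP w' xi : Lre mu w' (cs false ((2 * pi) *: (- xi))) = Lre mu w' (cs false ((2 * pi) *: xi)).
  by apply: eq_Lam => x; rewrite /cs scalerN dN cosN.
have H w' : W *m w' = 0 -> exists2 C : R, 0 <= C & forall k1 k2,
     let xi := k1 *: v1 + k2 *: v2 + eta in
     `|Lre mu w' (cs false ((2 * pi) *: xi))| <= C / (1 + `|k1| + `|k2|) /\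
     `|Lre mu (rotw w') (cs true ((2 * pi) *: xi))| <= C / (1 + `|k1| + `|k2|).
  move=> Ww'; have [C1 C10 h1] := pairing_decay eta Ww'; have [C2 C20 h2] := pairing_decay (- eta) Ww'.
  exists (C1 + C2); first exact: addr_ge0.
  move=> k1 k2 xi; have := h1 k1 k2; have := h2 (- k1) (- k2); rewrite !normrN.
  rewrite (_ : - k1 *: v1 + - k2 *: v2 - eta = - xi); last by rewrite !scaleNr -!opprD.
  rewrite -/xi !Re_pairing LP LN mulrDl !ler_norml => /andP[? ?] /andP[? ?].
  have c1 : 0 <= C1 / (1 + `|k1| + `|k2|) by rewrite divr_ge0// !addr_ge0.
  have c2 : 0 <= C2 / (1 + `|k1| + `|k2|) by rewrite divr_ge0// !addr_ge0.
  by split; apply/andP; split; lra.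
case: b.
  pose w' : 'cV[R[i]]_m := (Complex 0 1) *: w.
  have Ww' : W *m w' = 0 by rewrite /w' -scalemxAr Ww scaler0.
  have rw : rotw w' = w.
    rewrite /rotw /w' scalerA (_ : _ * _ = 1) ?scale1r//.
    by apply/eqP; rewrite eq_complex /=; apply/andP; split; apply/eqP; ring.
  have [C C0 h] := H w' Ww'; exists C => // k1 k2.
  by have [_] := h k1 k2; rewrite rw.
by have [C C0 h] := H w Ww; exists C => // k1 k2; have [] := h k1 k2.
Qed.

Lemma Lre_csM_le (w : 'cV[R[i]]_m) b b' (p q : 'rV[R]_n) g A : bmf g ->
  `|Lre mu w (fun x => cs (b (+) b') (p + q) x * g x)| <= A ->
  `|Lre mu w (fun x => cs (b (+) b') (p - q) x * g x)| <= A ->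
  `|Lre mu w (fun x => cs b p x * cs b' q x * g x)| <= A.
Proof.
move=> bg h1 h2; set k1 : R := if b && b' then -1 else 1; set k2 : R := if ~~ b && b' then -1 else 1.
have b1 xi : bmf (fun x => cs (b (+) b') xi x * g x) by apply: bmfM => //; exact: bmf_cs.
have -> : Lre mu w (fun x => cs b p x * cs b' q x * g x) =
   2^-1 * k1 * Lre mu w (fun x => cs (b (+) b') (p + q) x * g x) +
   2^-1 * k2 * Lre mu w (fun x => cs (b (+) b') (p - q) x * g x).
  rewrite /Lre -!LamZ// -LamD; [|exact: bmfZ..].
  by apply: eq_Lam => x; rewrite csM -/k1 -/k2; ring.
have n1 : `|k1| = 1 by rewrite /k1; case: ifP; rewrite ?normrN1 ?normr1.
have n2 : `|k2| = 1 by rewrite /k2; case: ifP; rewrite ?normrN1 ?normr1.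
apply: (le_trans (ler_normD _ _)); rewrite !normrM n1 n2 ger0_norm ?invr_ge0//.
by lra.
Qed.

(** Two product-to-sum steps leave the frequencies 2 pi (k1 v1 + k2 v2 + eta') with both signs of k2
    and of eta'. The constant adds up the cases of the sign of eta' and of sine or cosine. *)
Lemma bundle_decay (w : 'cV[R[i]]_m) (b : bool) (eta : 'rV[R]_n) : W *m w = 0 ->
  exists2 C : R, 0 <= C &
    decay (vparts mu) (vcoef w) (fun x => dotR v1 x) (fun x => dotR v2 x) C (cs b eta).
Proof.
move=> Ww.
have p0 : 2 * pi != 0 :> R by rewrite mulf_neq0 ?gt_eqF ?pi_gt0.
pose eta' := (2 * pi)^-1 *: eta.
have etaE : eta = (2 * pi) *: eta' by rewrite /eta' scalerA mulfV ?scale1r.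
pose C1 b := sval (cid2 (cs_decay b eta' Ww)); pose C2 b := sval (cid2 (cs_decay b (- eta') Ww)).
have h1 c : 0 <= C1 c /\ forall k1 k2,
    `|Lre mu w (cs c ((2 * pi) *: (k1 *: v1 + k2 *: v2 + eta')))| <= C1 c / (1 + `|k1| + `|k2|).
  by rewrite /C1; case: cid2.
have h2 c : 0 <= C2 c /\ forall k1 k2,
    `|Lre mu w (cs c ((2 * pi) *: (k1 *: v1 + k2 *: v2 + - eta')))| <= C2 c / (1 + `|k1| + `|k2|).
  by rewrite /C2; case: cid2.
pose C := C1 true + C2 true + (C1 false + C2 false).
have [p1 p2 p3 p4] : [/\ 0 <= C1 true, 0 <= C2 true, 0 <= C1 false & 0 <= C2 false].
  by split; [exact: (h1 _).1|exact: (h2 _).1|exact: (h1 _).1|exact: (h2 _).1].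
have C1le c : C1 c <= C by rewrite /C; case: c; lra.
have C2le c : C2 c <= C by rewrite /C; case: c; lra.
exists C; first by rewrite /C; lra.
move=> a1 a2.
have tgE a v (x : @Rn R n) : tg a (dotR v x) = cs a.1 ((2 * pi * a.2%:R) *: v) x.
  by rewrite /tg /cs dotRZ.
rewrite -/(Lre mu w _).
rewrite (_ : (fun x : @Rn R n => _) = (fun x => cs a1.1 ((2 * pi * a1.2%:R) *: v1) x *
    cs a2.1 ((2 * pi * a2.2%:R) *: v2) x * cs b eta x)); last first.
  by apply/funext => x; rewrite !tgE.
set k1 : R := a1.2%:R; set k2 : R := a2.2%:R.
have k10 : `|k1| = k1 by rewrite ger0_norm.
have k20 : `|k2| = k2 by rewrite ger0_norm.
have q0 : 0 < 1 + k1 + k2 by rewrite ltr_wpDr// ltr_wpDr.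
have step c p :
  (exists2 sg : bool, p = (2 * pi) *: (k1 *: v1 + (if sg then - k2 else k2) *: v2) & True) ->
    `|Lre mu w (fun x => cs c p x * cs b eta x)| <= C / (1 + k1 + k2).
  move=> [sg -> _]; have kk : `|if sg then - k2 else k2| = k2 by case: sg; rewrite ?normrN.
  set xi := _ + _.
  have -> : Lre mu w (fun x => cs c ((2 * pi) *: xi) x * cs b eta x) =
     Lre mu w (fun x => cs c ((2 * pi) *: xi) x * cs b eta x * 1).
    by apply: eq_Lam => x; rewrite mulr1.
  apply: Lre_csM_le; first exact: bmf_cst.
    rewrite etaE -scalerDr; have := (h1 (c (+) b)).2 k1 (if sg then - k2 else k2).
    rewrite k10 kk -/xi => h.
    rewrite (_ : Lre mu w _ = Lre mu w (cs (c (+) b) ((2 * pi) *: (xi + eta')))); last first.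
      by apply: eq_Lam => x; rewrite mulr1.
    by apply: (le_trans h); apply: ler_wpM2r; [rewrite invr_ge0; exact: ltW|exact: C1le].
  rewrite etaE -scalerBr; have := (h2 (c (+) b)).2 k1 (if sg then - k2 else k2).
  rewrite k10 kk -/xi => h.
  rewrite (_ : Lre mu w _ = Lre mu w (cs (c (+) b) ((2 * pi) *: (xi - eta')))); last first.
      by apply: eq_Lam => x; rewrite mulr1.
  by apply: (le_trans h); apply: ler_wpM2r; [rewrite invr_ge0; exact: ltW|exact: C2le].
apply: Lre_csM_le; first exact: bmf_cs.
  by apply: step; exists false => //; rewrite scalerDr !scalerA.
by apply: step; exists true => //; rewrite scaleNr scalerBr !scalerA.
Qed.

End BundleDecay.

(** * Values of the measure on Hausdorff null sets *)

Section NullSets.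
Context {R : realType} (n m : nat) (phi : 'rV[R]_n -> 'M[R[i]]_m) (mu : @vmeasure R n m).
Hypotheses (phi_bundle : homogeneous_line_bundle phi) (phi_lip : lipschitz_on_sphere phi).
Hypothesis mu_phi : in_M_phi phi mu.

Lemma tdist_dotR (v1 v2 x y : 'rV[R]_n) :
  tdist (dotR v1 x) (dotR v2 x) (dotR v1 y) (dotR v2 y) <=
   pi * (l1norm v1 + l1norm v2) * enorm (x - y).
Proof.
have H (v : 'rV[R]_n) : `|sin (pi * (dotR v x - dotR v y))| <= pi * (l1norm v * enorm (x - y)).
  apply: (le_trans (ler_norm_sin _)); rewrite normrM ger0_norm ?pi_ge0// ler_wpM2l ?pi_ge0//.
  rewrite /dotR -sumrB (le_trans (ler_norm_sum _ _ _))// mulr_suml; apply: ler_sum => i _.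
  rewrite -mulrBr normrM ler_wpM2l//; have := coord_le_enorm (x - y) i.
  by rewrite !mxE.
apply: (le_trans (lerD (H v1) (H v2))).
by rewrite le_eqVlt; apply/orP; left; apply/eqP; ring.
Qed.

Lemma vmeas_submx_of_null (V : 'M[R]_n) (W : 'M[R[i]]_m) (F : set (@Rn R n)) (s : R) :
  \rank V = 2%N -> (forall xi : 'rV[R]_n, (xi <= V)%MS -> xi != 0 -> (phi xi <= W)%MS) ->
  measurable F -> 0 <= s < 2 -> hausdorff_measure s F = 0%E -> (vmeas mu F <= W)%MS.
Proof.
move=> rV hVW mF /andP[s0 s2] H0.
have [v1 [v2 [K K0 hK]]] := span2 rV.
have phiW k1 k2 : k1 *: v1 + k2 *: v2 != 0 -> (phi (k1 *: v1 + k2 *: v2)%R <= W)%MS.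
  by apply: hVW; have [] := hK k1 k2.
have vK k1 k2 : `|k1| + `|k2| <= K * enorm (k1 *: v1 + k2 *: v2) by have [] := hK k1 k2.
pose s' := Num.max s 1.
have s'01 : 0 <= s' < 2 by rewrite le_max ler01 orbT gt_max s2 ltr1n.
(* It dominates the Lipschitz constant, for [tdist], of the map to the torus, so the covering of [F]
   becomes one by [tdist] balls of radii [r k i]; the 1 keeps it positive. *)
pose kappa := 1 + pi * (l1norm v1 + l1norm v2).
have kappa0 : 0 < kappa by rewrite ltr_wpDr// mulr_ge0 ?pi_ge0// addr_ge0// l1norm_ge0.
have e0 k : 0 < 2^-1 * 4^-1 ^+ k :> R by rewrite mulr_gt0// exprn_gt0.
have cov k := hausdorff_cover s0 H0 kappa0 (e0 k).
have [x hx] := choice cov; have [r hr] := choice hx.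
have r01 k i : 0 < r k i <= 1.
  have [r0 rs _] := hr k; rewrite r0/= leNgt; apply/negP => r1.
  have : r k i `^ s' <= 2^-1.
    apply: (@le_trans _ _ (2^-1 * 4^-1 ^+ k)).
      apply: le_trans (rs i.+1); rewrite big_ord_recr/= lerDr.
      by apply: sumr_ge0 => j _; exact: powR_ge0.
    by rewrite ler_piMr ?invr_ge0// exprn_ile1// invf_le1// ler1n.
  have : 1 <= r k i `^ s'.
    have : r k i <= r k i `^ s' by apply: le1r_powR; [exact: ltW|rewrite le_max lexx orbT].
    by apply: le_trans; exact: ltW.
  by lra.
have rs k N : \sum_(i < N) r k i `^ s' <= 2^-1 * 4^-1 ^+ k by have [_ h _] := hr k; exact: h.
have [f0 [bf0 f01 hf0]] := @limsup_bump _ _ _ (fun z : @Rn R n => dotR v1 z) (fun z => dotR v2 z) r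
  (fun k i => dotR v1 (x k i)) (fun k i => dotR v2 (x k i)) s' (measurable_dotR v1) (measurable_dotR v2)
  r01 s'01 rs.
have f0F z : F z -> f0 z = 1.
  move=> Fz; apply: f01 => k; have [_ _ /(_ z Fz)[i hi]] := hr k; exists i.
  apply: (le_trans (tdist_dotR _ _ _ _)); apply: le_trans hi.
  by rewrite ler_wpM2r ?enorm_ge0// /kappa lerDr.
have L0 (w : 'cV[R[i]]_m) : W *m w = 0 -> complex.Re ((vmeas mu F *m w) ord0 ord0) = 0.
  move=> Ww; rewrite Re_vmeas//.
  have f00 b eta : Lam (vparts mu) (vcoef w) (fun z => f0 z * cs b eta z) = 0.
    have [C C0 hC] := bundle_decay phi_bundle phi_lip mu_phi K0 phiW vK b eta Ww.
    exact: hf0 C0 (bmf_cs _ _) hC.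
  rewrite -[RHS](Lam_charf_eq0 bf0 f00 mF); apply: eq_Lam => z; rewrite /charf.
  have [Fz|Fz] := pselect (F z); first by rewrite f0F// mul1r.
  by rewrite asboolF// mulr0.
have Z (w : 'cV[R[i]]_m) : W *m w = 0 -> vmeas mu F *m w = 0.
  move=> Ww; apply/matrixP => i j; rewrite !ord1 [RHS]mxE.
  apply/eqP; rewrite eq_complex L0// Im_eq_Re_rotw L0 ?eqxx//.
  by rewrite -scalemxAr Ww scaler0.
(* The columns of [cokermx W] are killed by [W], and together they detect membership in its row
   space. *)
rewrite submxE; apply/eqP/matrixP => i j.
have E : W *m col j (cokermx W) = 0 by rewrite colE mulmxA mulmx_coker mul0mx.
by have := Z _ E; rewrite colE mulmxA -colE => /matrixP/(_ i ord0); rewrite mxE => ->; rewrite !mxE.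
Qed.

End NullSets.

Theorem theorem2 (R : realType) (n m : nat) (phi : 'rV[R]_n -> 'M[R[i]]_m)
  (mu : vmeasure n m) (l : nat) (V : 'I_l -> 'M[R]_n) (W : 'I_l -> 'M[R[i]]_m) :
  homogeneous_line_bundle phi ->
  lipschitz_on_sphere phi ->
  in_M_phi phi mu ->
  (forall i, \rank (V i) = 2%N) ->
  (forall i (xi : 'rV[R]_n), (xi <= V i)%MS -> xi != 0 -> (phi xi <= W i)%MS) ->
  (forall x : 'rV[R[i]]_m, (forall j, (x <= W j)%MS) -> x = 0) ->
  (2%:E <= hausdorff_dim_measure mu)%E.
Proof.
move=> bundle lip mu_phi rV hVW W0.
apply: le_ereal_inf_tmp => _ [F [mF muF] <-].
apply: le_ereal_inf_tmp => _ [s [s0 Hs] <-].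
rewrite lee_fin leNgt; apply/negP => s2.
move: muF; rewrite (W0 (vmeas mu F)) ?eqxx// => j.
by apply: (vmeas_submx_of_null bundle lip mu_phi (rV j) (hVW j) mF _ Hs); rewrite s0.
Qed.
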